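(* \textsc{Ext BP} with $n$ items can be solved in time $O^*(6^{n})$ using space $O^*(3^{n})$.
   Context: $O^*$ suppresses factors polynomial in the input size. \textsc{Ext BP}: the input is a finite set $X$ of $n$ items, a weight function $w$ assigning a rational number $w(x)\in(0,1)$ to each item, and a partition $\pi_U$ of $X$. A partition $\pi$ of $X$ is feasible if every block $Y\in\pi$ satisfies $\sum_{y\in Y}w(y)\le 1$. Write $\pi_1\le_X\pi_2$ if $\pi_2$ is a refinement of $\pi_1$. A feasible partition $\pi$ is minimal if there is no feasible partition $\pi'\neq\pi$ with $\pi'\le_X\pi$. The question is whether there exists a minimal feasible partition $\pi'$ with $\pi_U\le_X\pi'$. *)

(* Defs.v *)
From HB Require Import structures.
From mathcomp Require Import all_boot all_order all_algebra finmap.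

Set Implicit Arguments.
Unset Strict Implicit.
Unset Printing Implicit Defensive.

Import Order.TTheory GRing.Theory Num.Theory.

(** * Extension of bin packing *)

Section BinPacking.
Variable X : finType.
Implicit Types (w : X -> rat) (P Q : {set {set X}}).

(* The finer partition is the larger one. *)
Definition le_part P Q : bool :=
  [forall B in Q, exists A in P, B \subset A].

Definition feasible w P : bool :=
  partition P [set: X] && [forall Y in P, (\sum_(y in Y) w y <= 1)%R].

Definition minimal_feasible w P : bool :=
  feasible w P &&
  ~~ [exists Q, [&& feasible w Q, Q != P & le_part Q P]].

End BinPacking.

Record ext_bp := ExtBP {
  item : finType;
  weight : item -> rat;
  pre_sol : {set {set item}};
  weight_bounds : forall x, (0 < weight x < 1)%R;
  pre_sol_partition : partition pre_sol [set: item]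
}.

Definition nb_items (I : ext_bp) : nat := #|item I|.

Definition ext_bp_yes (I : ext_bp) : Prop :=
  exists P : {set {set item I}},
    minimal_feasible (@weight I) P /\ le_part (pre_sol I) P.

(* The number of items, followed by three words per item: numerator and
   denominator of the weight in lowest terms, and the rank of the first item
   that lies in the same block of the given partition. *)
Definition encode_ext_bp (I : ext_bp) : seq nat :=
  nb_items I ::
  flatten [seq [:: `|numq (weight x)|%N; `|denq (weight x)|%N;
                   find (fun y => y \in pblock (pre_sol I) x) (enum (item I))]
          | x <- enum (item I)].

(** * Random access machines with logarithmic cost *)

(* Length of the binary representation; 0 has length 1. *)
Definition nbits (m : nat) : nat := (trunc_log 2 m).+1.

Definition input_size (x : seq nat) : nat := \sum_(a <- x) nbits a.

(* [Sub] is truncated; [Div] is the quotient, and is 0 if the divisor is 0. *)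
Inductive binop := Add | Sub | Mul | Div.

Definition eval_binop (o : binop) : nat -> nat -> nat :=
  match o with Add => addn | Sub => subn | Mul => muln | Div => divn end.

(* Schoolbook bit complexity. *)
Definition binop_cost (o : binop) (a b : nat) : nat :=
  match o with
  | Add | Sub => nbits a + nbits b
  | Mul | Div => nbits a * nbits b
  end.

(* With M the memory and x the (read-only) input:
     Const r c    M[r] := c
     Op o r s t   M[r] := M[s] o M[t]
     Read r s     M[r] := M[M[s]]
     Write r s    M[M[r]] := M[s]
     Input r s    M[r] := x[M[s]]
     Jz r l       if M[r] = 0 then jump to instruction l *)
Inductive instr :=
  | Const of nat & nat
  | Op of binop & nat & nat & nat
  | Read of nat & nat
  | Write of nat & nat
  | Input of nat & nat
  | Jz of nat & nat.

Definition program := seq instr.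

(* The domain of the map is the set of registers written so far. *)
Definition memory := {fmap nat -> nat}.

Definition get (M : memory) (r : nat) : nat := odflt 0 (M.[? r])%fmap.

Definition put (M : memory) (r v : nat) : memory := (M.[r <- v])%fmap.

Definition config : Type := nat * memory.

Definition init_config : config := (0, [fmap]%fmap).

(* The machine halts when the program counter leaves the program. *)
Definition halted (p : program) (c : config) : bool := size p <= c.1.

Definition step (p : program) (x : seq nat) (c : config) : config :=
  let: (pc, M) := c in
  match onth p pc with
  | None => c
  | Some (Const r a) => (pc.+1, put M r a)
  | Some (Op o r s t) => (pc.+1, put M r (eval_binop o (get M s) (get M t)))
  | Some (Read r s) => (pc.+1, put M r (get M (get M s)))
  | Some (Write r s) => (pc.+1, put M (get M r) (get M s))
  | Some (Input r s) => (pc.+1, put M r (nth 0 x (get M s)))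
  | Some (Jz r l) => (if get M r == 0 then l else pc.+1, M)
  end.

(* Every address and every operand is charged its length. *)
Definition step_cost (p : program) (x : seq nat) (c : config) : nat :=
  let: (pc, M) := c in
  match onth p pc with
  | None => 0
  | Some (Const r a) => nbits r + nbits a
  | Some (Op o r s t) =>
      nbits r + nbits s + nbits t + binop_cost o (get M s) (get M t)
  | Some (Read r s) =>
      nbits r + nbits s + nbits (get M s) + nbits (get M (get M s))
  | Some (Write r s) =>
      nbits r + nbits s + nbits (get M r) + nbits (get M s)
  | Some (Input r s) =>
      nbits r + nbits s + nbits (get M s) + nbits (nth 0 x (get M s))
  | Some (Jz r l) => nbits r + nbits (get M r) + nbits l
  end.

Definition config_at (p : program) (x : seq nat) (k : nat) : config :=
  iter k (step p x) init_config.

Definition run_time (p : program) (x : seq nat) (k : nat) : nat :=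
  \sum_(i < k) step_cost p x (config_at p x i).

Definition mem_space (M : memory) : nat :=
  \sum_(r <- domf M) (nbits r + nbits (get M r)).

Definition run_space (p : program) (x : seq nat) (k : nat) : nat :=
  \max_(i < k.+1) mem_space (config_at p x i).2.

(* A halting computation accepts iff register 0 is nonzero. *)
Definition accepting (c : config) : bool := get c.2 0 != 0.

(* A single machine decides the problem [yes] in time O*(f(par)) and in space
   O*(g(par)), the suppressed factors being polynomials in the input size. *)
Definition solvable_Ostar (inst : Type) (encode : inst -> seq nat)
    (par : inst -> nat) (yes : inst -> Prop) (f g : nat -> nat) : Prop :=
  exists (p : program) (pt ps : {poly nat}), forall I : inst,
    let x := encode I in
    let N := input_size x in
    exists k : nat,
      [/\ halted p (config_at p x k),
          accepting (config_at p x k) <-> yes I,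
          run_time p x k <= pt.[N]%R * f (par I) &
          run_space p x k <= ps.[N]%R * g (par I)].

(* Main.v *)
(* A feasible partition is minimal iff any two of its blocks together weigh more
   than 1. If B is a lightest block, this says that every other block Y satisfies
   w(Y) >= w(B) and w(Y) + w(B) > 1, a condition on Y alone once B is fixed. So for
   each of the 2^n sets B, one decides whether the complement of B can be cut into
   admissible blocks by dynamic programming over subsets: S can be cut if S is the
   disjoint union of an admissible T and of some R that can be cut. The pairs
   (T, R) are the n-digit ternary numbers c (digit 1 for T, 2 for R), and all pairs
   with union R precede, as numbers, all pairs whose second component is R and
   whose first is nonempty, so that one increasing pass over the 3^n values of c
   suffices. With b the number whose binary digits describe B, a single loop over
   e = 3^n b + c < 6^n does everything; an entry of the table is the value b + 1 of
   the last b for which the set was found to be cuttable, so the table is never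
   reset. Rational weights are scaled by the product of all denominators. *)

From HB Require Import structures.
Require Import Defs.
From mathcomp Require Import all_boot all_order all_algebra finmap.
From mathcomp Require Import zify.

Set Implicit Arguments.
Unset Strict Implicit.
Unset Printing Implicit Defensive.

(** * Memories with bounded contents, and counted runs *)

Lemma get_put M r v r' : get (put M r v) r' = if r' == r then v else get M r'.
Proof. by rewrite /get /put fnd_set; case: eqP. Qed.

Lemma get_put_eq M r v : get (put M r v) r = v.
Proof. by rewrite get_put eqxx. Qed.

Lemma get_put_neq M r v r' : r' != r -> get (put M r v) r' = get M r'.
Proof. by rewrite get_put => /negbTE ->. Qed.

(** The invariant behind both resource bounds: [V] limits the operands and hence the cost of a step,
    [A] limits the addresses written and hence the space. *)
Definition good (A V : nat) (M : memory) : Prop :=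
  (forall r, get M r <= V) /\ (forall r, r \in domf M -> r < A).

Lemma good_put A V M r v :
  good A V M -> r < A -> v <= V -> good A V (put M r v).
Proof.
move=> [gV gA] rA vV; split=> r'; first by rewrite get_put; case: ifP.
by rewrite /put mem_setf inE => /orP[/eqP->|/gA].
Qed.

Section Reach.
Variables (p : program) (x : seq nat) (A V : nat).

(** Every intermediate configuration has to be [good], since time and space are charged along the
    whole run. *)
Definition reach (c : config) (k : nat) (c' : config) : Prop :=
  iter k (step p x) c = c' /\
  forall i, i <= k -> good A V (iter i (step p x) c).2.

Lemma reach0 c : good A V c.2 -> reach c 0 c.
Proof. by move=> gc; split=> // i; rewrite leqn0 => /eqP ->. Qed.

Lemma reach_good c k c' : reach c k c' -> good A V c'.2.
Proof. by case=> <- /(_ k (leqnn _)). Qed.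

Lemma reach_trans c1 c2 c3 k1 k2 :
  reach c1 k1 c2 -> reach c2 k2 c3 -> reach c1 (k1 + k2) c3.
Proof.
move=> [e1 g1] [e2 g2]; split; first by rewrite addnC iterD e1.
move=> i ik; case: (leqP i k1) => [/g1 //|k1i].
rewrite -(subnK (ltnW k1i)) iterD e1; apply: g2.
by rewrite leq_subLR.
Qed.

Lemma reach_step c c' : step p x c = c' -> good A V c.2 -> good A V c'.2 ->
  reach c 1 c'.
Proof.
by move=> e g g'; split=> // -[|[|i]] //= _; rewrite e.
Qed.

Lemma reach_rcons c k c1 pc M :
  reach c k c1 -> step p x c1 = (pc, M) -> good A V M -> reach c k.+1 (pc, M).
Proof.
move=> r1 e g; rewrite -addn1; apply: (reach_trans (r1) _).
exact: (reach_step e (reach_good r1) g).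
Qed.

Definition code_at (off : nat) (code : program) : Prop :=
  forall i, i < size code -> onth p (off + i) = onth code i.

Lemma code_at_cat off c1 c2 : code_at off (c1 ++ c2) ->
  code_at off c1 /\ code_at (off + size c1) c2.
Proof.
move=> h; split=> i il.
  rewrite h ?size_cat ?ltn_addr //.
  by rewrite onth_cat il.
rewrite -addnA h ?size_cat ?ltn_add2l //.
by rewrite onth_cat ltnNge leq_addr /= addKn.
Qed.

Lemma code_at_cons off i c : code_at off (i :: c) ->
  onth p off = Some i /\ code_at off.+1 c.
Proof.
rewrite -cat1s => /code_at_cat [h1 h2]; split; last by rewrite addn1 in h2.
by rewrite -[off]addn0 h1.
Qed.

End Reach.

(** * A structured language and its compilation *)

(** The registers below [nvars] are the variables [Vacc] to [VbadT]; the table lies from [tab_base]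
    upwards. *)
Definition nvars := 20.
Definition tab_base := 64.

Inductive expr :=
  | Var of nat
  | Cst of nat
  | Bin of binop & expr & expr
  | Inp of expr
  | Tab of expr.

Inductive cmd :=
  | Blk of seq (nat * expr)
  | Store of expr & expr
  | Seq of cmd & cmd
  | While of nat & cmd.

Definition state : Type := seq nat * (nat -> nat).

Definition input_at (x : seq nat) (i : nat) : nat := nth 0 x i.

Section Semantics.
Variables (x : seq nat) (A V : nat).

Fixpoint eval (st : state) (e : expr) : nat :=
  match e with
  | Var r => nth 0 st.1 r
  | Cst c => c
  | Bin o e1 e2 => eval_binop o (eval st e1) (eval st e2)
  | Inp e => input_at x (eval st e)
  | Tab e => st.2 (eval st e)
  end.

Definition upd (tab : nat -> nat) (i v : nat) : nat -> nat :=
  fun j => if j == i then v else tab j.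

Fixpoint sem_blk (b : seq (nat * expr)) (st : state) : state :=
  match b with
  | [::] => st
  | (r, e) :: b' => sem_blk b' (set_nth 0 st.1 r (eval st e), st.2)
  end.

(** Subexpressions are bounded too, because compiled code keeps each value in a register; for a
    table access the shifted address is such a value as well. *)
Fixpoint ebound (st : state) (e : expr) : Prop :=
  eval st e <= V /\
  match e with
  | Bin _ e1 e2 => ebound st e1 /\ ebound st e2
  | Inp e => ebound st e
  | Tab e => ebound st e /\ tab_base + eval st e <= V
  | _ => True
  end.

Fixpoint bbound (b : seq (nat * expr)) (st : state) : Prop :=
  match b with
  | [::] => True
  | (r, e) :: b' =>
      ebound st e /\ bbound b' (set_nth 0 st.1 r (eval st e), st.2)
  end.

End Semantics.

(* Register [nvars] is never written, hence a constant zero: adding it copies a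
   register, and jumping on it is unconditional. Registers above it, up to
   [tab_base], hold intermediate results. *)
Fixpoint comp_expr (e : expr) (t : nat) : program :=
  match e with
  | Var r => [:: Op Add t r nvars]
  | Cst c => [:: Const t c]
  | Bin o e1 e2 => comp_expr e1 t ++ comp_expr e2 t.+1 ++ [:: Op o t t t.+1]
  | Inp e => comp_expr e t ++ [:: Input t t]
  | Tab e => comp_expr e t ++
      [:: Const t.+1 tab_base; Op Add t t t.+1; Read t t]
  end.

Definition tmp := nvars.+1.

Fixpoint comp_blk (b : seq (nat * expr)) : program :=
  match b with
  | [::] => [::]
  | (r, e) :: b' => (comp_expr e tmp ++ [:: Op Add r tmp nvars]) ++ comp_blk b'
  end.

Definition comp_store (e1 e2 : expr) : program :=
  comp_expr e1 tmp ++ comp_expr e2 tmp.+1 ++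
  [:: Const tmp.+2 tab_base; Op Add tmp tmp tmp.+2; Write tmp tmp.+1].

Fixpoint compile (c : cmd) (off : nat) : program :=
  match c with
  | Blk b => comp_blk b
  | Store e1 e2 => comp_store e1 e2
  | Seq c1 c2 => let p1 := compile c1 off in p1 ++ compile c2 (off + size p1)
  | While r c => let p1 := compile c off.+1 in
      Jz r (off + size p1).+2 :: p1 ++ [:: Jz nvars off]
  end.

Fixpoint wf_expr (e : expr) (t : nat) : bool :=
  match e with
  | Var r => (r < nvars) && (t < tab_base)
  | Cst _ => t < tab_base
  | Bin _ e1 e2 => wf_expr e1 t && wf_expr e2 t.+1
  | Inp e => wf_expr e t
  | Tab e => wf_expr e t && (t.+1 < tab_base)
  end.

Fixpoint wf_cmd (c : cmd) : bool :=
  match c with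
  | Blk b => all (fun a => (a.1 < nvars) && wf_expr a.2 tmp) b
  | Store e1 e2 => wf_expr e1 tmp && wf_expr e2 tmp.+1
  | Seq c1 c2 => wf_cmd c1 && wf_cmd c2
  | While r c => (r < nvars) && wf_cmd c
  end.

Lemma wf_expr_lt e t : wf_expr e t -> t < tab_base.
Proof.
elim: e t => //= [r|o e1 IH1 e2 _|e IH] t; first by case/andP.
  by case/andP=> /IH1.
by case/andP=> /IH.
Qed.

(** The index is the exact number of machine steps. An iteration pays 2 beyond its body, for the
    test and the jump back; the failing test pays 1. *)
Inductive run (x : seq nat) (A V : nat) : cmd -> state -> nat -> state -> Prop :=
  | run_blk b st : bbound x V b st ->
      run x A V (Blk b) st (size (comp_blk b)) (sem_blk x b st)
  | run_store e1 e2 st :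
      ebound x V st e1 -> ebound x V st e2 ->
      tab_base + eval x st e1 <= V -> tab_base + eval x st e1 < A ->
      run x A V (Store e1 e2) st (size (comp_store e1 e2))
        (st.1, upd st.2 (eval x st e1) (eval x st e2))
  | run_seq c1 c2 st1 k1 st2 k2 st3 :
      run x A V c1 st1 k1 st2 -> run x A V c2 st2 k2 st3 ->
      run x A V (Seq c1 c2) st1 (k1 + k2) st3
  | run_while0 r c st : nth 0 st.1 r = 0 -> run x A V (While r c) st 1 st
  | run_whileS r c st1 k1 st2 k2 st3 : nth 0 st1.1 r != 0 ->
      run x A V c st1 k1 st2 -> run x A V (While r c) st2 k2 st3 ->
      run x A V (While r c) st1 (k1 + k2).+2 st3.

(** Registers strictly between [nvars] and [tab_base] are left free, so temporaries may be
    overwritten at will. *)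
Definition sim (M : memory) (st : state) : Prop :=
  [/\ get M nvars = 0,
      forall r, r < nvars -> get M r = nth 0 st.1 r &
      forall j, get M (tab_base + j) = st.2 j].

(** The share of the cost that depends on the instruction alone, hence bounded by a constant for a
    fixed program. *)
Definition static_cost (i : instr) : nat :=
  match i with
  | Const r a => nbits r + nbits a
  | Op _ r s t => nbits r + nbits s + nbits t
  | Read r s | Write r s | Input r s => nbits r + nbits s
  | Jz r l => nbits r + nbits l
  end.

Ltac reg_lia := unfold tmp, nvars, tab_base in *; lia.

(** * Correctness of the compilation *)

Section Correct.
Variables (p : program) (x : seq nat) (A V : nat).
Hypothesis AV : tab_base <= A.
Hypothesis bV : tab_base <= V.

(** The frame clause carries the induction: evaluating the second operand at [t.+1] leaves the first
    value in [t], the variables and the table intact. *)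
Lemma comp_expr_ok e t off M st :
  nvars < t -> wf_expr e t -> sim M st -> good A V M -> ebound x V st e ->
  code_at p off (comp_expr e t) ->
  exists M', [/\ reach p x A V (off, M) (size (comp_expr e t))
                   (off + size (comp_expr e t), M'),
                 get M' t = eval x st e &
                 forall r, (r < t) || (tab_base <= r) -> get M' r = get M r].
Proof.
elim: e t off M => /= [r|c|o e1 IH1 e2 IH2|e IH|e IH] t off M lt.
- move=> /andP[lr lt'] [M0 Mv Mt] gM [bv _] /code_at_cons[cp _].
  have gM' : good A V (put M t (get M r + get M nvars)).
    by apply: good_put=> //; [lia|rewrite M0 addn0 Mv].
  exists (put M t (get M r + get M nvars)); split.
  + by apply: reach_step => //=; rewrite cp addn1.
  + by rewrite get_put_eq M0 addn0 Mv.
  + by move=> r' hr; rewrite get_put_neq //; lia.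
- move=> lt' sM gM [bv _] /code_at_cons[cp _].
  have gM' : good A V (put M t c) by apply: good_put=> //; lia.
  exists (put M t c); split.
  + by apply: reach_step => //=; rewrite cp addn1.
  + by rewrite get_put_eq.
  + by move=> r' hr; rewrite get_put_neq //; lia.
- move=> /andP[w1 w2] sM gM [bv [b1 b2]].
  case/code_at_cat=> cp1 /code_at_cat[cp2 /code_at_cons[cp3 _]].
  have [M1 [r1 v1 f1]] := IH1 t off M lt w1 sM gM b1 cp1.
  have lt2 := wf_expr_lt w2.
  have sM1 : sim M1 st.
    case: sM => [M0 Mv Mt]; split.
    * by rewrite f1 // lt.
    * by move=> r lr; rewrite f1 ?Mv // (ltn_trans lr).
    * by move=> j; rewrite f1 // leq_addr orbT.
  have [M2 [r2 v2 f2]] := IH2 t.+1 _ M1 (ltnW lt) w2 sM1 (reach_good r1) b2 cp2.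
  have v1' : get M2 t = eval x st e1 by rewrite f2 ?ltnSn.
  exists (put M2 t (eval_binop o (get M2 t) (get M2 t.+1))); split.
  + rewrite !size_cat addn1 !addnS addnA.
    apply: (reach_rcons (reach_trans r1 r2) _ _); first by rewrite /step cp3.
    by apply: good_put; [exact: (reach_good r2)|lia|rewrite v1' v2].
  + by rewrite get_put_eq v1' v2.
  + move=> r hr; rewrite get_put_neq; last by lia.
    by rewrite f2 ?f1 //; lia.
- move=> w sM gM [bv b] /code_at_cat[cp1 /code_at_cons[cp2 _]].
  have [M1 [r1 v1 f1]] := IH t off M lt w sM gM b cp1.
  have lt2 := wf_expr_lt w.
  exists (put M1 t (nth 0 x (get M1 t))); split.
  + rewrite !size_cat addn1 !addnS.
    apply: (reach_rcons r1 _ _); first by rewrite /step cp2.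
    by apply: good_put; [exact: (reach_good r1)|lia|rewrite v1].
  + by rewrite get_put_eq v1.
  + move=> r hr; rewrite get_put_neq; last by lia.
    by rewrite f1.
- move=> /andP[w lt2] sM gM [bv [b bt]].
  case/code_at_cat=> cp1 /code_at_cons[cp2 /code_at_cons[cp3 ]].
  case/code_at_cons=> cp4 _.
  have [M1 [r1 v1 f1]] := IH t off M lt w sM gM b cp1.
  have gM1 := reach_good r1.
  set M2 := put M1 t.+1 tab_base.
  have gM2 : good A V M2 by apply: good_put => //; lia.
  set M3 := put M2 t (get M2 t + get M2 t.+1).
  have v3 : get M3 t = tab_base + eval x st e.
    rewrite /M3 get_put_eq /M2 get_put_eq get_put_neq; last by lia.
    by rewrite v1 addnC.
  have gM3 : good A V M3.
    apply: good_put => //; first by lia.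
    by move: v3; rewrite /M3 get_put_eq => ->.
  have v4 : get M3 (get M3 t) = st.2 (eval x st e).
    rewrite v3 /M3 get_put_neq; last by lia.
    rewrite /M2 get_put_neq; last by lia.
    rewrite f1 ?leq_addr ?orbT //; by case: sM.
  exists (put M3 t (get M3 (get M3 t))); split.
  + rewrite size_cat /= !addnS addn0.
    have r2 : reach p x A V (off, M) (size (comp_expr e t)).+1
        ((off + size (comp_expr e t)).+1, M2).
      by apply: (reach_rcons r1 _ gM2); rewrite /step cp2.
    have r3 : reach p x A V (off, M) (size (comp_expr e t)).+2
        ((off + size (comp_expr e t)).+2, M3).
      by apply: (reach_rcons r2 _ gM3); rewrite /step cp3.
    apply: (reach_rcons r3 _ _); first by rewrite /step cp4.
    by apply: good_put=> //; [lia|rewrite v4].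
  + by rewrite get_put_eq v4.
  + move=> r hr; rewrite get_put_neq; last by lia.
    rewrite get_put_neq; last by lia.
    by rewrite get_put_neq ?f1 //; lia.
Qed.

Lemma sim_frame M M' st t : nvars < t -> sim M st ->
  (forall r, (r < t) || (tab_base <= r) -> get M' r = get M r) -> sim M' st.
Proof.
move=> lt [M0 Mv Mt] f; split.
- by rewrite f // lt.
- by move=> r lr; rewrite f ?Mv // (ltn_trans lr).
- by move=> j; rewrite f // leq_addr orbT.
Qed.

Lemma comp_blk_ok b off M st :
  all (fun a => (a.1 < nvars) && wf_expr a.2 tmp) b ->
  sim M st -> good A V M -> bbound x V b st -> code_at p off (comp_blk b) ->
  exists2 M', reach p x A V (off, M) (size (comp_blk b))
                (off + size (comp_blk b), M') & sim M' (sem_blk x b st).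
Proof.
elim: b off M st => [|[r e] b IH] off M st /=.
  by move=> _ sM gM _ _; exists M => //; rewrite addn0; apply: reach0.
case/andP=> /andP[lr we] wb sM gM [be bb].
case/code_at_cat=> /code_at_cat[cp1 /code_at_cons[cp2 _]] cp3.
have [M1 [r1 v1 f1]] := comp_expr_ok (ltnSn _) we sM gM be cp1.
have [sM1 sM2 sM3] := sim_frame (ltnSn _) sM f1.
have lt := wf_expr_lt we.
have gM2 : good A V (put M1 r (get M1 tmp + get M1 nvars)).
  apply: good_put; [exact: (reach_good r1)|reg_lia|].
  (* The case analysis only unfolds [ebound], whose first conjunct bounds the value for every shape
     of [e]. *)
  by rewrite sM1 addn0 v1; case: (e) be => [?|?|???|?|?] [].
have sM' : sim (put M1 r (get M1 tmp + get M1 nvars))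
             (set_nth 0 st.1 r (eval x st e), st.2).
  split=> /=.
  - by rewrite get_put_neq ?sM1 //; reg_lia.
  - by move=> r' lr'; rewrite get_put nth_set_nth /= sM1 addn0 v1 sM2.
  - by move=> j; rewrite get_put_neq ?sM3 //; reg_lia.
have r2 : reach p x A V (off, M) (size (comp_expr e tmp ++ [:: Op Add r tmp nvars]))
  (off + size (comp_expr e tmp ++ [:: Op Add r tmp nvars]),
   put M1 r (get M1 tmp + get M1 nvars)).
  rewrite !size_cat addn1 !addnS.
  by apply: (reach_rcons r1 _ gM2); rewrite /step cp2.
have [M3 r3 s3] := IH _ _ _ wb sM' gM2 bb cp3.
by exists M3=> //; rewrite size_cat addnA; apply: (reach_trans r2 r3).
Qed.

Lemma comp_store_ok e1 e2 off M st :
  wf_expr e1 tmp && wf_expr e2 tmp.+1 -> sim M st -> good A V M ->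
  ebound x V st e1 -> ebound x V st e2 ->
  tab_base + eval x st e1 <= V -> tab_base + eval x st e1 < A ->
  code_at p off (comp_store e1 e2) ->
  exists2 M', reach p x A V (off, M) (size (comp_store e1 e2))
                (off + size (comp_store e1 e2), M') &
              sim M' (st.1, upd st.2 (eval x st e1) (eval x st e2)).
Proof.
case/andP=> w1 w2 sM gM b1 b2 hV hA.
case/code_at_cat=> cp1 /code_at_cat[cp2].
case/code_at_cons=> cp3 /code_at_cons[cp4 /code_at_cons[cp5 _]].
have [M1 [r1 v1 f1]] := comp_expr_ok (ltnSn _) w1 sM gM b1 cp1.
have sM1 := sim_frame (ltnSn _) sM f1.
have [M2 [r2 v2 f2]] := comp_expr_ok (ltnW (ltnSn _)) w2 sM1 (reach_good r1) b2 cp2.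
have sM2 := sim_frame (ltnW (ltnSn _)) sM1 f2.
have v1' : get M2 tmp = eval x st e1 by rewrite f2.
pose M3 := put M2 tmp.+2 tab_base.
have gM3 : good A V M3 by apply: good_put ; [exact: (reach_good r2)|reg_lia|].
pose M4 := put M3 tmp (get M3 tmp + get M3 tmp.+2).
have e4 : get M3 tmp + get M3 tmp.+2 = tab_base + eval x st e1.
  by rewrite /M3 get_put_eq get_put_neq // v1' addnC.
have gM4 : good A V M4 by apply: good_put => //; [reg_lia|rewrite e4].
have v4 : get M4 tmp.+1 = eval x st e2 by rewrite /M4 !get_put_neq.
have v4' : get M4 tmp = tab_base + eval x st e1 by rewrite /M4 get_put_eq e4.
exists (put M4 (get M4 tmp) (get M4 tmp.+1)).
  rewrite !size_cat /= !addnS addn0 addnA.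
  have r12 := reach_trans r1 r2.
  set k := _ + size (comp_expr e2 _) in r12.
  rewrite -addnA -/k in r12 cp3 cp4 cp5 *.
  have r3 : reach p x A V (off, M) k.+1 ((off + k).+1, M3).
    by apply: (reach_rcons r12 _ gM3); rewrite /step cp3.
  have r4 : reach p x A V (off, M) k.+2 ((off + k).+2, M4).
    by apply: (reach_rcons r3 _ gM4); rewrite /step cp4.
  apply: (reach_rcons r4 _ _); first by rewrite /step cp5.
  apply: good_put => //; first by rewrite v4'.
  by rewrite v4; case: (e2) b2 => [?|?|???|?|?] [].
case: sM2 => M20 M2v M2t; split=> /=.
- by rewrite v4' get_put_neq /M4 /M3 ?get_put_neq.
- move=> r lr; rewrite v4' get_put_neq; last by reg_lia.
  rewrite /M4 /M3 get_put_neq; last by reg_lia.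
  by rewrite get_put_neq ?M2v //; reg_lia.
- move=> j; rewrite get_put v4' eqn_add2l v4 /upd; case: eqP => // _.
  rewrite /M4 /M3 get_put_neq; last by reg_lia.
  by rewrite get_put_neq ?M2t //; reg_lia.
Qed.

(** The induction is on the execution, not on the command: after one iteration of a loop the program
    counter is back at [off], in front of the same code. *)
Lemma comp_ok c st k st' off M :
  run x A V c st k st' -> wf_cmd c -> sim M st -> good A V M ->
  code_at p off (compile c off) ->
  exists2 M', reach p x A V (off, M) k (off + size (compile c off), M') &
              sim M' st'.
Proof.
move=> h; elim: h off M => {c st k st'}.
- by move=> b st bb off M wb sM gM cp; apply: comp_blk_ok.
- by move=> e1 e2 st b1 b2 hV hA off M w sM gM cp; apply: comp_store_ok.
- move=> c1 c2 st1 k1 st2 k2 st3 _ IH1 _ IH2 off M /= /andP[w1 w2] sM gM.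
  case/code_at_cat=> cp1 cp2.
  have [M1 r1 s1] := IH1 _ _ w1 sM gM cp1.
  have [M2 r2 s2] := IH2 _ _ w2 s1 (reach_good r1) cp2.
  by exists M2 => //; rewrite size_cat addnA; apply: (reach_trans r1 r2).
- move=> r c st h off M /= /andP[lr w] sM gM /code_at_cons[cp _].
  exists M => //; apply: reach_step => //=.
  rewrite cp; case: sM => _ -> // _; rewrite h eqxx.
  by rewrite size_cat addn1 !addnS.
- move=> r c st1 k1 st2 k2 st3 h _ IH1 _ IH2 off M /= /andP[lr w] sM gM cp.
  case/code_at_cons: (cp) => cp0 /code_at_cat[cp1 /code_at_cons[cp2 _]].
  have [M1 r1 s1] := IH1 _ _ w sM gM cp1.
  have w' : (r < nvars) && wf_cmd c by rewrite lr.
  have r2 : reach p x A V (off, M) (k1.+2) (off, M1).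
    apply: (@reach_rcons _ _ _ _ _ _ (off.+1 + size (compile c off.+1), M1)).
    + rewrite -[k1.+1]add1n; apply: (reach_trans _ r1).
      apply: reach_step => //=.
      by rewrite cp0; case: sM => _ -> // _; rewrite (negbTE h).
    + by rewrite /step cp2; case: s1 => ->.
    + exact: (reach_good r1).
  have [M2 r3 s3] := IH2 off _ w' s1 (reach_good r1) cp.
  by exists M2 => //; apply: (reach_trans r2 r3).
Qed.

End Correct.

(** * Cost of a step and of a memory *)

Lemma step_cost_le p x A V (C B : nat) c :
  good A V c.2 -> (forall a, a <= V -> nbits a <= B) ->
  (forall i, nth 0 x i <= V) ->
  (forall i, i < size p -> static_cost (nth (Const 0 0) p i) <= C) ->
  step_cost p x c <= C + B * B + 2 * B.
Proof.
case: c => pc M /= [gV _] hB hx hC.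
case: (ltnP pc (size p)) => hp; last by rewrite onth_default.
have := hC _ hp; case E: (onth p pc) => [ins|] //.
rewrite (@onth_nth _ _ _ _ _ E).
have hb s : nbits (get M s) <= B by apply: hB.
have hb' s : nbits (nth 0 x s) <= B by apply: hB.
case: ins {E} => [r a|o r s t|r s|r s|r s|r l] /=.
- lia.
(* Multiplication and division account for [B * B]; all other instructions handle at most two
   operands or addresses of length [B]. *)
- have := leq_mul (hb s) (hb t); have := hb s; have := hb t.
  by case: o => /=; lia.
- by have := hb s; have := hb (get M s); lia.
- by have := hb s; have := hb r; lia.
- by have := hb s; have := hb' (get M s); lia.
- by have := hb r; lia.
Qed.

(** Distinct addresses below [A] number at most [A], and each is charged its own length and that of
    its content. *)
Lemma mem_space_le A V (B : nat) M :
  good A V M -> (forall a, a <= V -> nbits a <= B) ->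
  (forall a, a < A -> nbits a <= B) -> mem_space M <= A * (2 * B).
Proof.
move=> [gV gA] hB hA; rewrite /mem_space big_seq.
apply: leq_trans (_ : \sum_(r <- domf M | r \in domf M) (2 * B) <= _).
  by apply: leq_sum => r /gA /hA h1; have := hB _ (gV r); lia.
rewrite -big_seq big_const_seq count_predT iter_addn_0 mulnC leq_mul2r.
apply/orP; right; rewrite -[A in _ <= A](size_iota 0).
apply: uniq_leq_size; first exact: fset_uniq.
by move=> r /gA; rewrite mem_iota.
Qed.

Definition runle x A V c st C st' := exists2 k, k <= C & run x A V c st k st'.

Lemma runle_seq x A V c1 c2 st1 C1 st2 C2 st3 :
  runle x A V c1 st1 C1 st2 -> runle x A V c2 st2 C2 st3 ->
  runle x A V (Seq c1 c2) st1 (C1 + C2) st3.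
Proof.
move=> [k1 h1 r1] [k2 h2 r2].
by exists (k1 + k2); [exact: leq_add|exact: run_seq r1 r2].
Qed.

(** [F i] is the state after [i] iterations, with the loop variable counting down from [m]. The
    induction shifts [F] by one. *)
Lemma runle_loop x A V r c m C (F : nat -> state) :
  (forall i, i <= m -> nth 0 (F i).1 r = m - i) ->
  (forall i, i < m -> runle x A V c (F i) C (F i.+1)) ->
  runle x A V (While r c) (F 0) (m * C.+2).+1 (F m).
Proof.
elim: m F => [|m IH] F hr hc.
  by exists 1 => //; apply: run_while0; rewrite hr.
have [k1 h1 r1] := hc 0 isT.
have [|i im|k2 h2 r2] := IH (fun i => F i.+1).
- by move=> i im; rewrite hr.
- exact: hc.
exists (k1 + k2).+2; last by apply: run_whileS r1 r2; rewrite hr.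
by rewrite mulSn; lia.
Qed.

(* A value computed from numbers below [2 ^ s] by a straight-line block is below
   [2 ^ (s * w)], where the weight [w] depends on the code only. *)
Fixpoint wgt (ws : seq nat) (e : expr) : nat :=
  match e with
  | Var r => nth 1 ws r
  | Cst c => c.+1
  | Bin _ e1 e2 => wgt ws e1 + wgt ws e2
  | Inp e => (wgt ws e).+1
  | Tab e => wgt ws e + tab_base
  end.

Fixpoint wgt_blk (ws : seq nat) (b : seq (nat * expr)) : nat :=
  match b with
  | [::] => 0
  | (r, e) :: b' => wgt ws e + wgt_blk (set_nth 1 ws r (wgt ws e)) b'
  end.

(** * Growth of values in straight-line code *)

Section Weights.
Variables (x : seq nat) (s : nat).
Hypothesis s_gt0 : 0 < s.
Hypothesis x_le : forall i, nth 0 x i <= 2 ^ s.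

(** The default weight 1 stands for registers not yet assigned in the block, with contents at most
    [2 ^ s]. Positive weights are what allows sums to be bounded like products. *)
Definition weighted (ws vals : seq nat) :=
  forall r, 0 < nth 1 ws r /\ nth 0 vals r <= 2 ^ (s * nth 1 ws r).

Lemma wgt_gt0 ws vals e : weighted ws vals -> 0 < wgt ws e.
Proof.
move=> h; elim: e => //= [r|_ e1 IH1 e2 _|e IH]; first by case: (h r).
  by rewrite addn_gt0 IH1.
by rewrite addn_gt0 IH.
Qed.

Lemma leq_pow2 a b : a <= b -> 2 ^ (s * a) <= 2 ^ (s * b).
Proof. by move=> ab; rewrite leq_exp2l // leq_mul2l ab orbT. Qed.

Lemma leq_cst c w : c < w -> c <= 2 ^ (s * w).
Proof.
move=> cw; apply: leq_trans (ltnW (ltn_expl c (isT : 1 < 2))) _.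
by rewrite leq_exp2l //; nia.
Qed.

(** Both powers are at least 2, and the sum of two such numbers is at most their product. *)
Lemma leq_add_pow2 a b v w : 0 < v -> 0 < w ->
  a <= 2 ^ (s * v) -> b <= 2 ^ (s * w) -> a + b <= 2 ^ (s * (v + w)).
Proof.
move=> v0 w0 ha hb; rewrite mulnDr expnD.
have h1 : 2 <= 2 ^ (s * v) by rewrite -{1}(expn1 2) leq_exp2l //; nia.
have h2 : 2 <= 2 ^ (s * w) by rewrite -{1}(expn1 2) leq_exp2l //; nia.
by nia.
Qed.

Lemma eval_le ws st e : weighted ws st.1 -> (forall j, st.2 j <= 2 ^ s) ->
  eval x st e <= 2 ^ (s * wgt ws e).
Proof.
move=> hw ht; elim: e => /= [r|c|o e1 IH1 e2 IH2|e _|e _].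
- by case: (hw r).
- exact: leq_cst.
- have w1 := wgt_gt0 e1 hw; have w2 := wgt_gt0 e2 hw.
  have h := leq_add_pow2 w1 w2 IH1 IH2.
  case: o => /=; first exact: h.
  + by apply: leq_trans h; lia.
  + by rewrite mulnDr expnD leq_mul.
  + by apply: leq_trans (leq_div _ _) _; lia.
- by apply: leq_trans (x_le _) _; rewrite leq_exp2l // leq_pmulr.
- by apply: leq_trans (ht _) _; rewrite leq_exp2l // leq_pmulr // addn_gt0 orbT.
Qed.

Lemma tab_eval_le ws st e : weighted ws st.1 -> (forall j, st.2 j <= 2 ^ s) ->
  tab_base + eval x st e <= 2 ^ (s * (wgt ws e + tab_base.+1)).
Proof.
move=> hw ht; rewrite addnC; apply: leq_add_pow2 => //.
- exact: wgt_gt0 hw.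
- exact: eval_le.
- exact: leq_cst.
Qed.

Lemma weighted_ebound m ws st e :
  weighted ws st.1 -> (forall j, st.2 j <= 2 ^ s) -> wgt ws e < m ->
  ebound x (2 ^ (s * m)) st e.
Proof.
move=> hw ht; elim: e => [r|c|o e1 IH1 e2 IH2|e IH|e IH] hm; split;
  try by apply: leq_trans (eval_le _ hw ht) (leq_pow2 (ltnW hm)).
all: rewrite //=.
- by split; [apply: IH1|apply: IH2]; rewrite /= in hm; lia.
- by apply: IH; rewrite /= in hm; lia.
- split; first by apply: IH; rewrite /= in hm; lia.
  apply: leq_trans (tab_eval_le _ hw ht) (leq_pow2 _).
  by rewrite /= in hm; lia.
Qed.

Lemma weighted_set ws vals r v w : weighted ws vals -> 0 < w ->
  v <= 2 ^ (s * w) -> weighted (set_nth 1 ws r w) (set_nth 0 vals r v).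
Proof. by move=> h w0 hv r'; rewrite !nth_set_nth /=; case: eqP. Qed.

Lemma weighted_bbound m ws b st :
  weighted ws st.1 -> (forall j, st.2 j <= 2 ^ s) -> wgt_blk ws b < m ->
  bbound x (2 ^ (s * m)) b st.
Proof.
elim: b ws st => [|[r e] b IH] //= ws st hw ht hm; split.
  by apply: weighted_ebound hw ht _; lia.
apply: (IH (set_nth 1 ws r (wgt ws e))) => //; last by lia.
by apply: weighted_set => //; [exact: wgt_gt0 hw|exact: eval_le].
Qed.

Lemma weighted_nil vals : all (fun v => v <= 2 ^ s) vals -> weighted [::] vals.
Proof.
move=> h r; rewrite nth_nil muln1; split=> //.
case: (ltnP r (size vals)) => hr; last by rewrite nth_default.
by move/(all_nthP 0): h; apply.
Qed.

End Weights.

(** * The program *)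

Notation "a [+] b" := (Bin Add a b) (at level 50, left associativity).
Notation "a [-] b" := (Bin Defs.Sub a b) (at level 50, left associativity).
Notation "a [*] b" := (Bin Mul a b) (at level 40, left associativity).
Notation "a [/] b" := (Bin Div a b) (at level 40, left associativity).

(** The remainder is rebuilt from the quotient; in [EDist] one of the truncated differences is 0, so
    the sum is the absolute difference. *)
Definition EMod a b := a [-] b [*] (a [/] b).
Definition EDist a b := (a [-] b) [+] (b [-] a).

Definition Vacc := 0.
Definition Vn := 1.
Definition Vleft := 2.
Definition Vptr := 3.
Definition VD := 4.
Definition V3n := 5.
Definition Vtodo := 6.
Definition Ve := 7.
Definition Vb1 := 8.
Definition Vb := 9.
Definition Vc := 10.
Definition Vpow := 11.
Definition VR := 12.
Definition VS := 13.
Definition VwB := 14.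
Definition VwT := 15.
(* The group of the first selected item; groups are numbered from 1, so that 0
   means that no item is selected yet. *)
Definition VgB := 16.
Definition VgT := 17.
Definition VbadB := 18.
Definition VbadT := 19.

Definition blk_init : seq (nat * expr) :=
  [:: (Vn, Inp (Cst 0)); (Vleft, Var Vn); (Vptr, Cst 1); (VD, Cst 1);
      (V3n, Cst 1); (Vtodo, Cst 1)].

Definition blk_powers : seq (nat * expr) :=
  [:: (VD, Var VD [*] Inp (Var Vptr [+] Cst 1)); (V3n, Var V3n [*] Cst 3);
      (Vtodo, Var Vtodo [*] Cst 6); (Vptr, Var Vptr [+] Cst 3);
      (Vleft, Var Vleft [-] Cst 1)].

(** The digit loop consumes [Vb] and [Vc]; [Vb1] keeps [b + 1] for the table. *)
Definition blk_prep : seq (nat * expr) :=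
  [:: (Vleft, Var Vn); (Vptr, Cst 1); (Vb, Var Ve [/] Var V3n);
      (Vc, EMod (Var Ve) (Var V3n)); (Vb1, Var Vb [+] Cst 1); (Vpow, Cst 1);
      (VR, Cst 0); (VS, Cst 0); (VwB, Cst 0); (VwT, Cst 0);
      (VgB, Cst 0); (VgT, Cst 0); (VbadB, Cst 0); (VbadT, Cst 0)].

Definition EbitB := EMod (Var Vb) (Cst 2).
(** For a ternary digit, the quotient by 2 is 1 exactly for the digit 2 and the remainder is 1
    exactly for the digit 1; this separates [R] from [T] without a jump. *)
Definition EbitR := EMod (Var Vc) (Cst 3) [/] Cst 2.
Definition EbitT := EMod (EMod (Var Vc) (Cst 3)) (Cst 2).
Definition Eweight :=
  Inp (Var Vptr) [*] (Var VD [/] Inp (Var Vptr [+] Cst 1)).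
Definition Egroup := Inp (Var Vptr [+] Cst 2) [+] Cst 1.

(** The factor [1 - VgB] (or [1 - VgT]) is 1 only while no group is recorded, so the first selected
    item fixes the group. [VbadB] also collects every item that does not lie in exactly one of B, T
    and R. *)
Definition blk_item : seq (nat * expr) :=
  [:: (VwB, Var VwB [+] EbitB [*] Eweight);
      (VwT, Var VwT [+] EbitT [*] Eweight);
      (VgB, Var VgB [+] (Cst 1 [-] Var VgB) [*] (EbitB [*] Egroup));
      (VgT, Var VgT [+] (Cst 1 [-] Var VgT) [*] (EbitT [*] Egroup));
      (VbadB, Var VbadB [+] (EbitB [*] EDist (Var VgB) Egroup [+]
                            EDist (EbitB [+] (EbitT [+] EbitR)) (Cst 1)));
      (VbadT, Var VbadT [+] EbitT [*] EDist (Var VgT) Egroup);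
      (VR, Var VR [+] EbitR [*] Var Vpow);
      (VS, Var VS [+] (EbitT [+] EbitR) [*] Var Vpow);
      (Vpow, Var Vpow [*] Cst 3); (Vb, Var Vb [/] Cst 2); (Vc, Var Vc [/] Cst 3);
      (Vptr, Var Vptr [+] Cst 3); (Vleft, Var Vleft [-] Cst 1)].

(* By truncation, each summand vanishes iff one of the conditions holds. *)
Definition Esucc :=
  Cst 1 [-] ((Var VwT [-] Var VD) [+] Var VbadT [+]
            Var VwT [*] ((Var VwB [-] Var VwT) [+]
                        ((Var VD [+] Cst 1) [-] (Var VwT [+] Var VwB))) [+]
            Var VR [*] EDist (Tab (Var VR)) (Var Vb1)).

(** Both factors are 0 or 1, so their product is a conjunction, and [Vacc] counts the successful
    rounds. *)
Definition blk_acc : seq (nat * expr) :=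
  [:: (Vacc, Var Vacc [+]
        Esucc [*] (Cst 1 [-] (Var VbadB [+] (Var VwB [-] Var VD))))].

(** The write happens in every round: it restores the old entry unless [Esucc] is 1, in which case
    an entry not above [b + 1] becomes [b + 1]. *)
Definition Eentry := Tab (Var VS) [+] Esucc [*] (Var Vb1 [-] Tab (Var VS)).

Definition blk_next : seq (nat * expr) :=
  [:: (Ve, Var Ve [+] Cst 1); (Vtodo, Var Vtodo [-] Cst 1)] ++ blk_prep.

Definition outer_body : cmd :=
  Seq (While Vleft (Blk blk_item))
    (Seq (Blk blk_acc) (Seq (Store (Var VS) Eentry) (Blk blk_next))).

Definition main_cmd : cmd :=
  Seq (Blk blk_init)
    (Seq (While Vleft (Blk blk_powers))
       (Seq (Blk blk_prep) (While Vtodo outer_body))).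

Definition ext_bp_program : program := compile main_cmd 0.

(** One exponent for all blocks of the program: a sum dominates each of its terms. *)
Definition weight_max : nat :=
  (wgt_blk [::] blk_init + wgt_blk [::] blk_powers + wgt_blk [::] blk_prep +
   wgt_blk [::] blk_item + wgt_blk [::] blk_acc + wgt [::] (Var VS) +
   wgt [::] Eentry + wgt_blk [::] blk_next + tab_base).+1.

Lemma lt_weight_max :
  [/\ wgt_blk [::] blk_init < weight_max, wgt_blk [::] blk_powers < weight_max,
      wgt_blk [::] blk_prep < weight_max, wgt_blk [::] blk_item < weight_max &
      wgt_blk [::] blk_acc < weight_max] /\
  [/\ wgt [::] (Var VS) + tab_base < weight_max,
      wgt [::] Eentry < weight_max & wgt_blk [::] blk_next < weight_max].
Proof.
rewrite /weight_max.
(* The weights become variables, so that the arithmetic does not depend on evaluating them. *)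
move: (wgt_blk _ _) (wgt_blk _ blk_powers) (wgt_blk _ blk_prep) => w1 w2 w3.
move: (wgt_blk _ _) (wgt_blk _ blk_acc) (wgt_blk _ _) => w4 w5 w6.
by move: (wgt _ _) (wgt _ _) tab_base => w7 w8 t; do !split; lia.
Qed.

(** The left side is the step count of [main_cmd]: an [n]-fold loop, then [P] rounds that each
    contain another one. [main_run] takes [6 ^ n] for [P]. *)
Lemma steps_le n P c1 c2 c3 c4 c5 c6 c7 : 0 < P ->
  c1 + ((n * c2.+2).+1 +
        (c3 + (P * ((n * c4.+2).+1 + (c5 + (c6 + c7))).+2).+1)) <=
  5 * ((c1 + c2 + c3 + c4 + c5 + c6 + c7 + 3) * n.+1 * P).
Proof.
move=> hP; set C := c1 + _ + _ + _ + _ + _ + _; set Q := (C + 3) * n.+1.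
have hQ : C + n * c2 + n * 2 + 3 <= Q by rewrite /Q /C; nia.
have hQ4 : (n * c4.+2).+1 + (c5 + (c6 + c7)) + 2 <= Q by rewrite /Q /C; nia.
have hPQ : P * ((n * c4.+2).+1 + (c5 + (c6 + c7)) + 2) <= Q * P.
  by rewrite mulnC leq_mul2r hQ4 orbT.
have hQP : Q <= Q * P by rewrite leq_pmulr.
by rewrite -addn2 /C in hQ *; nia.
Qed.

Definition size_max : nat :=
  size (comp_blk blk_init) + size (comp_blk blk_powers) +
  size (comp_blk blk_prep) + size (comp_blk blk_item) + size (comp_blk blk_acc) +
  size (comp_store (Var VS) Eentry) + size (comp_blk blk_next).

Lemma main_cmd_wf : wf_cmd main_cmd. Proof. by []. Qed.

(** * What the program computes *)

Definition dist (a b : nat) := (a - b) + (b - a).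

Lemma dist_eq0 a b : (dist a b == 0) = (a == b).
Proof. by rewrite /dist; lia. Qed.

Definition digB (b i : nat) := (b %/ 2 ^ i) %% 2.
Definition digR (c i : nat) := ((c %/ 3 ^ i) %% 3) %/ 2.
Definition digT (c i : nat) := ((c %/ 3 ^ i) %% 3) %% 2.

Definition codeR (c j : nat) := \sum_(i < j) digR c i * 3 ^ i.
Definition codeS (c j : nat) := \sum_(i < j) (digT c i + digR c i) * 3 ^ i.

Section Spec.
Variable x : seq nat.
Let n := input_at x 0.

(** Word 0 holds the number of items, and item [i] occupies the words [3 * i + 1] to [3 * i + 3].
    The sums stay unreduced to agree with the evaluated expressions. *)
Definition in_num i := input_at x (3 * i + 1).
Definition in_den i := input_at x (3 * i + 1 + 1).
Definition in_grp i := input_at x (3 * i + 1 + 2) + 1.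

Definition den_prod j := \prod_(i < j) in_den i.
Definition scaled i := in_num i * (den_prod n %/ in_den i).

Definition wsum (a : nat -> nat) j := \sum_(i < j) a i * scaled i.

Fixpoint first_grp (a : nat -> nat) j :=
  match j with
  | 0 => 0
  | j.+1 => first_grp a j + (1 - first_grp a j) * (a j * in_grp j)
  end.

(** The index [i.+1] lets item [i] fix the group itself before it is compared, as in [blk_item]. *)
Definition mixed (a : nat -> nat) j :=
  \sum_(i < j) a i * dist (first_grp a i.+1) (in_grp i).

Definition badB b c j :=
  \sum_(i < j) (digB b i * dist (first_grp (digB b) i.+1) (in_grp i) +
                dist (digB b i + (digT c i + digR c i)) 1).

Definition succ (tab : nat -> nat) b c :=
  let D := den_prod n in
  let wT := wsum (digT c) n in
  let wB := wsum (digB b) n in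
  let R := codeR c n in
  1 - ((wT - D) + mixed (digT c) n +
       wT * ((wB - wT) + ((D + 1) - (wT + wB))) +
       R * dist (tab R) (b + 1)).

Definition okB b c :=
  1 - (badB b c n + (wsum (digB b) n - den_prod n)).

(** Pure model of the main loop, giving accumulator and table after [e] rounds; the correctness
    proof of the dynamic program is about this function and not about the machine. *)
Fixpoint hist (e : nat) : nat * (nat -> nat) :=
  match e with
  | 0 => (0, fun _ => 0)
  | e.+1 =>
    let: (acc, tab) := hist e in
    let b := e %/ 3 ^ n in
    let c := e %% 3 ^ n in
    let S := codeS c n in
    (acc + succ tab b c * okB b c,
     upd tab S (tab S + succ tab b c * (b + 1 - tab S)))
  end.

(** Loop invariants as explicit register contents, in the order [Vacc] to [VbadT], after [j]
    iterations over the items. *)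
Definition powers_vals j : seq nat :=
  [:: 0; n; n - j; 3 * j + 1; den_prod j; 3 ^ j; 6 ^ j;
      0; 0; 0; 0; 0; 0; 0; 0; 0; 0; 0; 0; 0].

Definition item_vals acc e j : seq nat :=
  let b := e %/ 3 ^ n in
  let c := e %% 3 ^ n in
  [:: acc; n; n - j; 3 * j + 1; den_prod n; 3 ^ n; 6 ^ n - e; e; b + 1;
      b %/ 2 ^ j; c %/ 3 ^ j; 3 ^ j; codeR c j; codeS c j;
      wsum (digB b) j; wsum (digT c) j; first_grp (digB b) j;
      first_grp (digT c) j; badB b c j; mixed (digT c) j].

Lemma mod_eq a b : a - b * (a %/ b) = a %% b.
Proof. by have := divn_eq a b; lia. Qed.

Lemma sem_init tab :
  sem_blk x blk_init (nseq nvars 0, tab) = (powers_vals 0, tab).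
Proof.
rewrite /powers_vals /den_prod big_ord0 subn0 !expn0.
by cbv [sem_blk eval eval_binop set_nth nth fst snd ncons iter nseq nvars
        blk_init Vn Vleft Vptr VD V3n Vtodo].
Qed.

Ltac exec := cbv [sem_blk eval eval_binop set_nth nth fst snd cat
  blk_powers blk_prep blk_item blk_acc blk_next Esucc EMod EDist EbitB EbitR EbitT Eweight
  Egroup Vacc Vn Vleft Vptr VD V3n Vtodo Ve Vb1 Vb Vc Vpow VR VS VwB VwT VgB
  VgT VbadB VbadT powers_vals item_vals].

Lemma sem_powers tab j : 
  sem_blk x blk_powers (powers_vals j, tab) = (powers_vals j.+1, tab).
Proof.
exec; congr (_, _).
rewrite !expnSr /den_prod big_ord_recr /= subn1 subnS.
by rewrite (mulnSr 3 j) (addnAC _ 3 1).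
Qed.

Lemma sem_prep tab :
  sem_blk x blk_prep (powers_vals n, tab) = (item_vals 0 0 0, tab).
Proof.
exec; move: (6 ^ n) (3 ^ n) => P6 P3.
rewrite expn0 (mod_eq 0 P3) !subn0 !divn1.
by rewrite /codeR /codeS /wsum /badB /mixed !big_ord0.
Qed.

Lemma sem_next acc e tab :
  sem_blk x blk_next (item_vals acc e n, tab) = (item_vals acc e.+1 0, tab).
Proof.
exec; move: (6 ^ n) (3 ^ n) => P6 P3.
rewrite (addn1 e) expn0 (mod_eq e.+1 P3) !subn0 !divn1 subn1 subnS.
by rewrite /codeR /codeS /wsum /badB /mixed !big_ord0.
Qed.

Lemma sem_item acc e tab j :
  sem_blk x blk_item (item_vals acc e j, tab) = (item_vals acc e j.+1, tab).
Proof.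
exec; congr (_, _).
move: (6 ^ n) (3 ^ n) => P6 P3.
set b := e %/ _; set c := e %% _.
rewrite (mod_eq (b %/ 2 ^ j) 2) (mod_eq (c %/ 3 ^ j) 3).
rewrite (mod_eq ((c %/ 3 ^ j) %% 3) 2).
rewrite -/(digB _ _) -/(digR _ _) -/(digT _ _).
rewrite -/(in_num j) -/(in_den j) -/(in_grp j) -/(scaled j).
rewrite -!/(first_grp _ j.+1) -!/(dist _ _).
rewrite -!divnMA -!expnSr subn1 subnS (mulnSr 3 j) (addnAC _ 3 1).
by rewrite /codeR /codeS /wsum /mixed /badB !big_ord_recr.
Qed.

Lemma eval_succ acc e tab :
  eval x (item_vals acc e n, tab) Esucc = succ tab (e %/ 3 ^ n) (e %% 3 ^ n).
Proof. by exec. Qed.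

Lemma sem_acc acc e tab :
  sem_blk x blk_acc (item_vals acc e n, tab) =
  (item_vals (acc + succ tab (e %/ 3 ^ n) (e %% 3 ^ n) *
                      okB (e %/ 3 ^ n) (e %% 3 ^ n)) e n, tab).
Proof. by exec. Qed.

Lemma codeS_lt c j : codeS c j < 3 ^ j.
Proof.
elim: j => [|j IH]; first by rewrite /codeS big_ord0.
rewrite /codeS big_ord_recr -/(codeS c j) /= expnS.
suff: digT c j + digR c j <= 2 by nia.
by rewrite /digT /digR; lia.
Qed.

Lemma codeR_le c j : codeR c j <= codeS c j.
Proof. by apply: leq_sum => i _; rewrite leq_mul2r leq_addl orbT. Qed.

Lemma digB_le1 b i : digB b i <= 1.
Proof. by rewrite -ltnS ltn_mod. Qed.

Lemma digT_le1 c i : digT c i <= 1.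
Proof. by rewrite -ltnS ltn_mod. Qed.

(** A round adds at most 1 to the accumulator, and an updated entry is at most the larger of its old
    value and [b + 1], where [b <= e]. *)
Lemma hist_le e : (hist e).1 <= e /\ forall j, (hist e).2 j <= e.
Proof.
elim: e => //= e; case: (hist e) => acc tab /= [ha ht]; split.
  have h1 : succ tab (e %/ 3 ^ n) (e %% 3 ^ n) <= 1 by rewrite leq_subr.
  have h2 : okB (e %/ 3 ^ n) (e %% 3 ^ n) <= 1 by rewrite leq_subr.
  by nia.
move=> j; rewrite /upd; case: eqP => _; last exact: leq_trans (ht j) _.
have h1 : succ tab (e %/ 3 ^ n) (e %% 3 ^ n) <= 1 by rewrite leq_subr.
have := ht (codeS (e %% 3 ^ n) n).
have : e %/ 3 ^ n <= e by rewrite leq_div.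
move: h1; set s := succ _ _ _; set v := tab _; set b := e %/ _ => h1 hb hv.
by nia.
Qed.

(** * Numerical bounds on the register contents, and the run of the whole program *)

Section Bounds.
Variable N : nat.
Hypothesis N_gt0 : 0 < N.
Hypothesis n_le : 3 * n <= N.
Hypothesis x_le : forall i, nth 0 x i <= 2 ^ N.
Hypothesis den_prod_le : forall j, j <= n -> den_prod j <= 2 ^ N.
Hypothesis num_le_den : forall i, i < n -> in_num i <= in_den i.

Let U := 2 ^ N.
(** The registers stay below [5 * U ^ 2], and [5 <= 2 ^ 3 <= U ^ 3] bounds this by
    [U ^ 5 = 2 ^ s]. *)
Let s := 5 * N.

Lemma U_ge2 : 2 <= U. Proof. by rewrite -{1}(expn1 2) leq_exp2l. Qed.

Lemma NU : N < U. Proof. exact: ltn_expl. Qed.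

(** [6 ^ j <= 8 ^ j = 2 ^ (3 * j)], and each item contributes at least 3 to [N]. *)
Lemma pow6_le j : j <= n -> 6 ^ j <= U.
Proof.
move=> jn; apply: leq_trans (_ : 8 ^ j <= _).
  by case: j {jn} => // j; rewrite leq_exp2r.
by rewrite -[8]/(2 ^ 3) -expnM leq_exp2l //; lia.
Qed.

Lemma pow3_le6 j : 3 ^ j <= 6 ^ j.
Proof. by case: j => // j; rewrite leq_exp2r. Qed.

Lemma scaled_le i : i < n -> scaled i <= U.
Proof.
move=> hi; apply: leq_trans (den_prod_le (leqnn n)).
apply: leq_trans (leq_divM _ (in_den i)).
by rewrite /scaled mulnC leq_mul2l num_le_den ?orbT.
Qed.

Lemma in_grp_le i : in_grp i <= U.+1.
Proof. by rewrite /in_grp addn1 ltnS x_le. Qed.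

Lemma first_grp_le a j : (forall i, a i <= 1) -> first_grp a j <= U.+1.
Proof.
move=> ha; elim: j => //= j IH; have := ha j; have := in_grp_le j.
by move: (first_grp a j) (in_grp j) (a j) IH => [|l] g [|[|k]] //=; lia.
Qed.

Lemma leq_sum_const (F : nat -> nat) j m : j <= n ->
  (forall i, i < n -> F i <= m) -> \sum_(i < j) F i <= U * m.
Proof.
move=> jn h; apply: leq_trans (_ : j * m <= _).
  rewrite -[j in j * _]card_ord -sum_nat_const.
  by apply: leq_sum => i _; apply: h; apply: leq_trans jn.
by rewrite leq_mul2r; apply/orP; right; have := NU; lia.
Qed.

Lemma leq_U5 v : v <= 5 * (U * U) -> v <= 2 ^ s.
Proof.
move=> h; apply: leq_trans h _; rewrite /s (mulnC 5 N) expnM -/U.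
rewrite (expnD U 3 2) leq_mul ?mulnn //.
by apply: leq_trans (_ : 2 ^ 3 <= _); rewrite ?leq_exp2r ?U_ge2.
Qed.

Lemma item_vals_le acc e j : acc <= 6 ^ n -> e <= 6 ^ n -> j <= n ->
  all (fun v => v <= 2 ^ s) (item_vals acc e j).
Proof.
move=> hacc he hj.
have h6 := pow6_le (leqnn n); have h36 := pow3_le6 n.
have hb : e %/ 3 ^ n <= e by rewrite leq_div.
have hc : e %% 3 ^ n <= e by rewrite leq_mod.
have hU := U_ge2; have hN := NU.
have hD := den_prod_le (leqnn n).
have h3j : 3 ^ j <= 6 ^ n by apply: leq_trans h36; rewrite leq_exp2l.
set b := e %/ 3 ^ n in hb *; set c := e %% 3 ^ n in hc *.
have hS := codeS_lt c j; have hR := codeR_le c j.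
have hw a : (forall i, a i <= 1) -> wsum a j <= U * U.
  move=> ha; apply: (leq_sum_const (F := fun i => a i * scaled i)) => // i hi.
  by have := ha i; have := scaled_le hi; nia.
have hd a i : (forall i, a i <= 1) ->
    a i * dist (first_grp a i.+1) (in_grp i) <= 2 * U + 2.
  move=> ha; have := ha i; have := first_grp_le i.+1 ha; have := in_grp_le i.
  by rewrite /dist; move: (first_grp _ _) (in_grp _) (a i) => l g [|[|k]]; lia.
have hm a : (forall i, a i <= 1) -> mixed a j <= U * (2 * U + 2).
  move=> ha; apply: (leq_sum_const
    (F := fun i => a i * dist (first_grp a i.+1) (in_grp i))) => // i hi.
  exact: hd.
(* Of the constant 5, 2 comes from the group distance and 3 bounds the covering test. *)
have hbad : badB b c j <= U * (2 * U + 5).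
  apply: (leq_sum_const (F := fun i => digB b i *
    dist (first_grp (digB b) i.+1) (in_grp i) +
    dist (digB b i + (digT c i + digR c i)) 1)) => // i hi.
  have h1 := hd (digB b) i (digB_le1 b).
  have : dist (digB b i + (digT c i + digR c i)) 1 <= 3.
    by have := digB_le1 b i; rewrite /dist /digT /digR; lia.
  by lia.
have hwB := hw _ (digB_le1 b); have hwT := hw _ (digT_le1 c).
have hgB := first_grp_le j (digB_le1 b); have hgT := first_grp_le j (digT_le1 c).
have hmT := hm _ (digT_le1 c).
have hbj : b %/ 2 ^ j <= b by rewrite leq_div.
have hcj : c %/ 3 ^ j <= c by rewrite leq_div.
rewrite /item_vals /all -/b -/c; do !(apply/andP; split=> //); apply: leq_U5; nia.
Qed.

Lemma powers_vals_le j : j <= n ->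
  all (fun v => v <= 2 ^ s) (powers_vals j).
Proof.
move=> hj; have hU := U_ge2; have hN := NU; have h6 := pow6_le hj.
have h36 := pow3_le6 j; have hD := den_prod_le hj.
rewrite /powers_vals /all; do !(apply/andP; split=> //); apply: leq_U5; nia.
Qed.

(** The table is indexed by values of [codeS], all below [3 ^ n]; the space bound originates
    here. *)
Let A := tab_base + 3 ^ n.
Let V := 2 ^ (s * weight_max).

Lemma s_gt0 : 0 < s. Proof. by rewrite /s; lia. Qed.

Lemma x_le_s i : nth 0 x i <= 2 ^ s.
Proof. by apply: leq_trans (x_le i) _; rewrite leq_exp2l // /s; lia. Qed.

Lemma hist_tab_le e j : e <= 6 ^ n -> (hist e).2 j <= 2 ^ s.
Proof.
move=> he; apply: leq_trans (proj2 (hist_le e) j) (leq_trans he _).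
apply: leq_trans (pow6_le (leqnn n)) _.
by rewrite leq_exp2l // /s; lia.
Qed.

Lemma bounded_blk b vals tab : wgt_blk [::] b < weight_max ->
  all (fun v => v <= 2 ^ s) vals -> (forall j, tab j <= 2 ^ s) ->
  runle x A V (Blk b) (vals, tab) (size (comp_blk b)) (sem_blk x b (vals, tab)).
Proof.
move=> hw hv ht; exists (size (comp_blk b)) => //; apply: run_blk.
apply: (weighted_bbound s_gt0 x_le_s (ws := [::])) => //.
exact: weighted_nil.
Qed.

Lemma item_loop_run acc e tab : acc <= 6 ^ n -> e <= 6 ^ n ->
  (forall j, tab j <= 2 ^ s) ->
  runle x A V (While Vleft (Blk blk_item)) (item_vals acc e 0, tab)
    (n * (size (comp_blk blk_item)).+2).+1 (item_vals acc e n, tab).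
Proof.
move=> ha he ht; apply: (runle_loop (F := fun j => (item_vals acc e j, tab))) => //.
move=> j jn; rewrite -sem_item; apply: bounded_blk ht;
  last by apply: item_vals_le => //; exact: ltnW.
by have [[? ? ? ? ?] [? ? ?]] := lt_weight_max; assumption.
Qed.

Lemma powers_loop_run tab : (forall j, tab j <= 2 ^ s) ->
  runle x A V (While Vleft (Blk blk_powers)) (powers_vals 0, tab)
    (n * (size (comp_blk blk_powers)).+2).+1 (powers_vals n, tab).
Proof.
move=> ht; apply: (runle_loop (F := fun j => (powers_vals j, tab))) => //.
move=> j jn; rewrite -sem_powers; apply: bounded_blk ht;
  last by apply: powers_vals_le; exact: ltnW.
by have [[? ? ? ? ?] [? ? ?]] := lt_weight_max; assumption.
Qed.

Lemma store_run acc e tab : acc <= 6 ^ n -> e <= 6 ^ n ->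
  (forall j, tab j <= 2 ^ s) ->
  let b := e %/ 3 ^ n in
  let S := codeS (e %% 3 ^ n) n in
  runle x A V (Store (Var VS) Eentry) (item_vals acc e n, tab)
    (size (comp_store (Var VS) Eentry))
    (item_vals acc e n,
     upd tab S (tab S + succ tab b (e %% 3 ^ n) * (b + 1 - tab S))).
Proof.
move=> ha he ht b S; eexists; first exact: leqnn.
have hw : weighted s [::] (item_vals acc e n, tab).1.
  by apply: weighted_nil; apply: item_vals_le.
have -> : tab S + succ tab b (e %% 3 ^ n) * (b + 1 - tab S) =
  eval x (item_vals acc e n, tab) Eentry by rewrite /b -(eval_succ acc); exec.
have [_ [h1 h2 _]] := lt_weight_max.
apply: (run_store (e1 := Var VS)).
- apply: (weighted_ebound s_gt0 x_le_s hw ht).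
  by apply: leq_ltn_trans h1; rewrite leq_addr.
- exact: (weighted_ebound s_gt0 x_le_s hw ht).
- apply: leq_trans (tab_eval_le s_gt0 x_le_s (Var VS) hw ht) _.
  by apply: leq_pow2 => //; rewrite addnS.
- by rewrite ltn_add2l; exact: codeS_lt.
Qed.

Lemma outer_body_run e : e < 6 ^ n ->
  runle x A V outer_body (item_vals (hist e).1 e 0, (hist e).2)
    ((n * (size (comp_blk blk_item)).+2).+1 + (size (comp_blk blk_acc) +
       (size (comp_store (Var VS) Eentry) + size (comp_blk blk_next))))
    (item_vals (hist e.+1).1 e.+1 0, (hist e.+1).2).
Proof.
move=> he; have [ha _] := hist_le e; have [ha' _] := hist_le e.+1.
have ht := fun j => hist_tab_le j (ltnW he).
have ht' := fun j => hist_tab_le j he.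
move: ha ha' ht ht' => /=; case: (hist e) => acc tab /= ha ha' ht ht'.
have {}ha := leq_trans ha (ltnW he); have {}ha' := leq_trans ha' he.
apply: runle_seq (item_loop_run ha (ltnW he) ht) _.
apply: runle_seq.
  apply: bounded_blk ht;
  last by apply: item_vals_le => //; exact: ltnW.
  by have [[? ? ? ? ?] [? ? ?]] := lt_weight_max; assumption.
rewrite sem_acc.
apply: runle_seq (store_run ha' (ltnW he) ht) _.
rewrite -sem_next; apply: bounded_blk ht';
  last by apply: item_vals_le => //; exact: ltnW.
by have [[? ? ? ? ?] [? ? ?]] := lt_weight_max; assumption.
Qed.

Lemma main_run :
  runle x A V main_cmd (nseq nvars 0, fun _ => 0)
    (5 * ((size_max + 3) * n.+1 * 6 ^ n))
    (item_vals (hist (6 ^ n)).1 (6 ^ n) 0, (hist (6 ^ n)).2).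
Proof.
have ht0 (j : nat) : 0 <= 2 ^ s by [].
have r1 : runle x A V (Blk blk_init) (nseq nvars 0, fun _ => 0)
    (size (comp_blk blk_init)) (powers_vals 0, fun _ => 0).
  rewrite -sem_init; apply: (bounded_blk _ _ ht0); last by rewrite all_nseq.
  by have [[? ? ? ? ?] [? ? ?]] := lt_weight_max; assumption.
have r2 := powers_loop_run ht0.
have r3 : runle x A V (Blk blk_prep) (powers_vals n, fun _ => 0)
    (size (comp_blk blk_prep)) (item_vals 0 0 0, fun _ => 0).
  rewrite -sem_prep; apply: (bounded_blk _ _ ht0); last exact: powers_vals_le.
  by have [[? ? ? ? ?] [? ? ?]] := lt_weight_max; assumption.
(* [item_vals] puts [6 ^ n - e] into [Vtodo], so the condition on the loop variable holds by
   computation. *)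
have r4 := runle_loop (r := Vtodo) (m := 6 ^ n)
  (F := fun e => (item_vals (hist e).1 e 0, (hist e).2))
  (fun e _ => erefl _) outer_body_run.
have [k hk r] := runle_seq r1 (runle_seq r2 (runle_seq r3 r4)).
exists k => //; apply: leq_trans hk _.
have : 0 < 6 ^ n by rewrite expn_gt0.
exact: steps_le.
Qed.

End Bounds.
End Spec.

(** * Correctness of the dynamic program *)

Lemma sum_digits_lt q n (d : nat -> nat) : 0 < q -> (forall i, d i < q) ->
  \sum_(i < n) d i * q ^ i < q ^ n.
Proof.
move=> q0 dq; elim: n => [|n IH]; first by rewrite big_ord0.
rewrite big_ord_recr expnS /=.
apply: (@leq_trans ((d n).+1 * q ^ n)); last by rewrite leq_mul2r dq orbT.
by rewrite mulSn ltn_add2r.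
Qed.

(** Each induction step strips the lowest digit: the other terms form a multiple of [q], and a digit
    below [q] vanishes in the quotient. *)
Lemma sum_digits_digit q n (d : nat -> nat) k : 0 < q -> (forall i, d i < q) ->
  k < n -> (\sum_(i < n) d i * q ^ i) %/ q ^ k %% q = d k.
Proof.
move=> q0; elim: k n d => [|k IH] [|n] d dq // kn; rewrite big_ord_recl /=.
  rewrite expn0 divn1 muln1.
  under eq_bigr do rewrite expnSr mulnA.
  by rewrite -big_distrl /= addnC modnMDl modn_small.
rewrite expn0 muln1 expnS divnMA.
under eq_bigr do rewrite expnSr mulnA.
rewrite -big_distrl /= divnDr ?dvdn_mull // mulnK // (divn_small (dq 0)) add0n.
exact: (IH n (fun i => d i.+1)).
Qed.

(** * Testing whether the selected items share a group *)

Section FirstGroup.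
Variables (x : seq nat) (a : nat -> nat).
Hypothesis a_le1 : forall i, a i <= 1.

Lemma first_grpP j :
  (forall i, i < j -> a i = 0) /\ first_grp x a j = 0 \/
  exists i, [/\ i < j, a i = 1 & first_grp x a j = in_grp x i].
Proof.
elim: j => [|j IH]; first by left.
rewrite /=; case: IH => [[h ->]|[i [ij ai ->]]]; last first.
  right; exists i; split=> //; first exact: ltnW.
  (* Groups are numbered from 1, so a recorded group makes the factor [1 - first_grp] vanish. *)
  by rewrite /in_grp; lia.
rewrite subn0 mul1n add0n; have := a_le1 j; case E: (a j) => [|[|//]] _.
  left; rewrite mul0n; split=> // i; rewrite ltnS leq_eqVlt.
  by case/orP=> [/eqP->//|/h].
by right; exists j; rewrite mul1n.
Qed.

(** Each selected item is compared with the first one only; transitivity of equality extends this to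
    all pairs. *)
Lemma mixed_eq0 j : reflect
  (forall i k, i < j -> k < j -> a i = 1 -> a k = 1 -> in_grp x i = in_grp x k)
  (mixed x a j == 0).
Proof.
apply: (iffP eqP).
  elim: j => // j IH; rewrite /mixed big_ord_recr -/(mixed x a j).
  move/eqP; rewrite addn_eq0 => /andP[/eqP/IH {}IH h].
  have key i : i < j -> a i = 1 -> a j = 1 -> in_grp x i = in_grp x j.
    move=> ij ai aj; move: h; rewrite [nat_of_ord _]/= aj mul1n dist_eq0 => /eqP <-.
    case: (first_grpP j) => [[h0 _]|[k [kj ak /= ->]]].
      by have := h0 _ ij; rewrite ai.
    by rewrite (IH i k) // /in_grp; lia.
  move=> i k; rewrite !ltnS (leq_eqVlt i) (leq_eqVlt k) =>
    /orP[/eqP->|ij] /orP[/eqP->|kj] // ai ak.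
  - by rewrite (key k).
  - exact: key.
  - exact: IH.
move=> h; apply: big1 => i _; have := a_le1 i; case E: (a i) => [|[|//]] _ //.
apply/eqP; rewrite mul1n dist_eq0.
case: (first_grpP i.+1) => [[h0 _]|[k [ki ak ->]]].
  by have := h0 i (ltnSn _); rewrite E.
by apply/eqP; apply: h => //; apply: leq_trans ki _.
Qed.

End FirstGroup.

(** * Sets of items as numbers *)

Section Dynamic.
Variables (X : finType) (x : seq nat).
Local Notation n := (input_at x 0).
Hypothesis n_card : n = #|X|.
Implicit Types (S T R B Y : {set X}) (Q : {set {set X}}).

Definition itm (y : X) : nat := enum_rank y.

Lemma itm_lt y : itm y < n. Proof. by rewrite n_card ltn_ord. Qed.

Lemma itm_inj : injective itm.
Proof. by move=> y z /val_inj /enum_rank_inj. Qed.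

Lemma sum_items (F : nat -> nat) : \sum_(i < n) F i = \sum_y F (itm y).
Proof.
by rewrite n_card (reindex (@enum_rank X)) //; apply: onW_bij (@enum_rank_bij X).
Qed.

Lemma all_items (P : nat -> Prop) : (forall i, i < n -> P i) <-> forall y, P (itm y).
Proof.
split=> [h y|h i]; first exact: h (itm_lt y).
rewrite n_card => ic; have -> : i = itm (enum_val (Ordinal ic)); last exact: h.
by rewrite /itm enum_valK.
Qed.

Definition bits S (i : nat) : nat := [exists y in S, itm y == i].

Lemma bits_itm S y : bits S (itm y) = (y \in S).
Proof.
congr nat_of_bool; apply/exists_inP/idP => [[z zS /eqP/itm_inj <-]//|yS].
by exists y.
Qed.

Lemma bits_le1 S i : bits S i <= 1. Proof. exact: leq_b1. Qed.

(** Base 2 numbers the candidates for [B]; base 3 indexes the table, in agreement with [codeR] and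
    [codeS]. *)
Definition code q S := \sum_(y in S) q ^ itm y.

Lemma code_bits q S : code q S = \sum_(i < n) bits S i * q ^ i.
Proof.
rewrite (sum_items (fun i => bits S i * q ^ i)) /code big_mkcond /=.
by apply: eq_bigr => y _; rewrite bits_itm; case: (y \in S); rewrite ?mul1n.
Qed.

Lemma code_inj S S' : code 3 S = code 3 S' -> S = S'.
Proof.
rewrite !code_bits => h; apply/setP=> y.
have d A i : bits A i < 3 by apply: leq_ltn_trans (bits_le1 A i) _.
have := sum_digits_digit (q := 3) isT (d S) (itm_lt y).
rewrite h (sum_digits_digit (q := 3) isT (d S') (itm_lt y)) !bits_itm.
by case: (y \in S); case: (y \in S').
Qed.

Lemma code_gt0 S : S != set0 -> 0 < code 3 S.
Proof.
case/set0Pn=> y yS; rewrite /code (big_setD1 y) //= ltn_addr //.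
by rewrite expn_gt0.
Qed.

Lemma code_setU S S' : [disjoint S & S'] -> code 3 (S :|: S') = code 3 S + code 3 S'.
Proof. by move=> d; rewrite /code -bigU //=; apply: eq_bigl => y; rewrite !inE. Qed.

Definition selB b := [set y | digB b (itm y) == 1].
Definition selT c := [set y | digT c (itm y) == 1].
Definition selR c := [set y | digR c (itm y) == 1].

Lemma digR_le1 c i : digR c i <= 1. Proof. by rewrite /digR; lia. Qed.

Lemma digTR c i : digT c i + digR c i <= 1. Proof. by rewrite /digT /digR; lia. Qed.

Lemma sel_disjoint c : [disjoint selT c & selR c].
Proof.
rewrite -setI_eq0; apply/eqP/setP=> y; rewrite !inE.
by have := digTR c (itm y); lia.
Qed.

Lemma sel_sum (d : nat -> nat) (F : nat -> nat) : (forall i, d i <= 1) ->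
  \sum_(i < n) d i * F i = \sum_(y | d (itm y) == 1) F (itm y).
Proof.
move=> hd; rewrite (sum_items (fun i => d i * F i)) [RHS]big_mkcond /=.
apply: eq_bigr => y _.
by have := hd (itm y); case: (d (itm y)) => [|[|]] // _; rewrite mul1n.
Qed.

Lemma codeR_sel c : codeR c n = code 3 (selR c).
Proof.
rewrite /codeR (sel_sum (d := digR c) (fun i => 3 ^ i) (digR_le1 c)) /code.
by apply: eq_bigl => y; rewrite inE.
Qed.

Lemma codeS_sel c : codeS c n = code 3 (selT c :|: selR c).
Proof.
rewrite /codeS (sel_sum (d := fun i => digT c i + digR c i) (fun i => 3 ^ i) (digTR c)).
rewrite /code; apply: eq_bigl => y; rewrite !inE.
by have := digTR c (itm y); lia.
Qed.

Lemma selB_code B : selB (code 2 B) = B.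
Proof.
apply/setP=> y; rewrite inE code_bits /digB.
have d i : bits B i < 2 by rewrite ltnS bits_le1.
by rewrite (sum_digits_digit (q := 2) isT d (itm_lt y)) bits_itm; case: (y \in B).
Qed.

Lemma code2_lt B : code 2 B < 2 ^ n.
Proof.
by rewrite code_bits; apply: sum_digits_lt => // i; rewrite ltnS bits_le1.
Qed.

(** * Pairs of disjoint sets as ternary numbers *)

Definition code_pair T R := code 3 T + 2 * code 3 R.

Lemma code_pairE T R :
  code_pair T R = \sum_(i < n) (bits T i + 2 * bits R i) * 3 ^ i.
Proof.
rewrite /code_pair !code_bits big_distrr /= -big_split /=.
by apply: eq_bigr => i _; rewrite mulnDl mulnA.
Qed.

Section Pair.
Variables (T R : {set X}).
Hypothesis TR : [disjoint T & R].

Lemma bits_disjoint i : bits T i + bits R i <= 1.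
Proof.
rewrite /bits; case: exists_inP => [[y yT /eqP <-]|_]; last exact: leq_b1.
case: exists_inP => [[z zR /eqP/itm_inj ezy]|//].
by move: TR => /disjointFr/(_ yT); rewrite -ezy zR.
Qed.

Lemma code_pair_lt : code_pair T R < 3 ^ n.
Proof.
rewrite code_pairE; apply: (@sum_digits_lt 3 n (fun i => bits T i + 2 * bits R i)) => // i.
by have := bits_disjoint i; lia.
Qed.

Lemma code_pair_digit y :
  (code_pair T R %/ 3 ^ itm y) %% 3 = (y \in T) + 2 * (y \in R).
Proof.
rewrite code_pairE.
rewrite (@sum_digits_digit 3 n (fun i => bits T i + 2 * bits R i)) ?itm_lt //.
  by rewrite !bits_itm.
by move=> i; have := bits_disjoint i; lia.
Qed.

Lemma selT_pair : selT (code_pair T R) = T.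
Proof.
apply/setP=> y; rewrite inE /digT code_pair_digit.
have := bits_disjoint (itm y); rewrite !bits_itm.
by case: (y \in T); case: (y \in R).
Qed.

Lemma selR_pair : selR (code_pair T R) = R.
Proof.
apply/setP=> y; rewrite inE /digR code_pair_digit.
have := bits_disjoint (itm y); rewrite !bits_itm.
by case: (y \in T); case: (y \in R).
Qed.

End Pair.

(** * Admissible blocks and the tests performed in a round *)

Definition load Y := \sum_(y in Y) scaled x (itm y).
Definition one_group Y :=
  [forall y in Y, forall z in Y, in_grp x (itm y) == in_grp x (itm z)].

Hypothesis scaled_gt0 : forall y, 0 < scaled x (itm y).

Local Notation D := (den_prod x n).

Definition good_block B Y :=
  [&& load Y <= D, one_group Y, load B <= load Y & D < load Y + load B].

Definition packing B S Q := partition Q S && [forall Y in Q, good_block B Y].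

Lemma load_eq0 S : (load S == 0) = (S == set0).
Proof.
apply/idP/eqP => [h|->]; last by rewrite /load big_set0.
apply/setP=> y; rewrite inE; apply: contraTF h => yS.
by rewrite /load (big_setD1 y) //= -lt0n ltn_addr.
Qed.

Lemma wsum_selT c : wsum x (digT c) n = load (selT c).
Proof.
rewrite /wsum (sel_sum (scaled x) (digT_le1 c)).
by apply: eq_bigl => y; rewrite inE.
Qed.

Lemma wsum_selB b : wsum x (digB b) n = load (selB b).
Proof.
rewrite /wsum (sel_sum (scaled x) (digB_le1 b)).
by apply: eq_bigl => y; rewrite inE.
Qed.

Lemma mixed_sel (d : nat -> nat) S : (forall i, d i <= 1) ->
  (forall y, (y \in S) = (d (itm y) == 1)) -> (mixed x d n == 0) = one_group S.
Proof.
move=> hd hS; apply/mixed_eq0/forall_inP => // h.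
  move=> y; rewrite hS => /eqP dy; apply/forall_inP=> z; rewrite hS => /eqP dz.
  by apply/eqP; apply: h; rewrite ?itm_lt.
move=> i k hi hk; move: i hi k hk.
apply/all_items => y; apply/all_items => z /eqP; rewrite -hS => yS /eqP.
by rewrite -hS => zS; apply/eqP; move: (h y yS) => /forall_inP; apply.
Qed.

Lemma succ_le1 tab b c : succ x tab b c <= 1. Proof. exact: leq_subr. Qed.

(** As scaled weights are positive, [wT] and the code of [R] vanish only on the empty set; as
    factors in [succ] they switch off the tests exactly there. *)
Lemma succE tab b c : (succ x tab b c == 1) =
  ((selT c == set0) || good_block (selB b) (selT c)) &&
  ((selR c == set0) || (tab (code 3 (selR c)) == b + 1)).
Proof.
rewrite /succ wsum_selT wsum_selB codeR_sel.
rewrite /good_block -(mixed_sel (digT_le1 c)); last by move=> y; rewrite inE.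
(* The mixing test does not carry the factor [wT], but vanishes by itself on an empty [T]. *)
have hT : selT c = set0 -> mixed x (digT c) n = 0.
  move=> h; apply/eqP; rewrite (mixed_sel (S := set0) (digT_le1 c)).
    by apply/forall_inP=> y; rewrite inE.
  by move=> y; rewrite -h inE.
have eR : (code 3 (selR c) == 0) = (selR c == set0).
  apply/idP/eqP=> [|->]; last by rewrite /code big_set0.
  by apply: contraTeq => /code_gt0; rewrite -lt0n.
have sub1 k : (1 - k == 1) = (k == 0) by case: k.
rewrite -eR -load_eq0 sub1 !addn_eq0 !muln_eq0 dist_eq0 !addn_eq0 !subn_eq0 addn1.
have [eT|_] := eqVneq (load (selT c)) 0; last by rewrite !orFb !andbA.
by rewrite eT leq0n hT //; apply/eqP; rewrite -load_eq0 eT.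
Qed.

Lemma okBE b c : (okB x b c == 1) =
  [&& load (selB b) <= D, one_group (selB b) & selT c :|: selR c == ~: selB b].
Proof.
have sub1 k : (1 - k == 1) = (k == 0) by case: k.
(* The distances vanish iff each item lies in exactly one of B, T and R; as T and R are disjoint in
   any case, their union is then the complement of B. *)
have cover : (\sum_(i < n) dist (digB b i + (digT c i + digR c i)) 1 == 0) =
    (selT c :|: selR c == ~: selB b).
  rewrite (sum_items (fun i => dist (digB b i + (digT c i + digR c i)) 1)).
  rewrite sum_nat_eq0; apply/forallP/eqP => [h|h y].
    apply/setP=> y; have := h y; rewrite /= dist_eq0 !inE.
    by have := digB_le1 b (itm y); have := digTR c (itm y); lia.
  move/setP/(_ y): h; rewrite /= dist_eq0 !inE.
  by have := digB_le1 b (itm y); have := digTR c (itm y); lia.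
rewrite /okB sub1 addn_eq0 subn_eq0 wsum_selB /badB big_split /= addn_eq0 cover.
rewrite -/(mixed x (digB b) n) (mixed_sel (S := selB b) (digB_le1 b)).
  by rewrite andbC.
by move=> y; rewrite inE.
Qed.

(** * Soundness and persistence of table entries *)

Local Notation tab e := (hist x e).2.
Local Notation acc e := (hist x e).1.

Lemma tabS e j : tab e.+1 j =
  let b := e %/ 3 ^ n in let c := e %% 3 ^ n in
  let S := code 3 (selT c :|: selR c) in
  if j == S then tab e S + succ x (tab e) b c * (b + 1 - tab e S) else tab e j.
Proof. by rewrite /=; case: (hist x e) => a t /=; rewrite codeS_sel. Qed.

Lemma accS e : acc e.+1 =
  acc e + succ x (tab e) (e %/ 3 ^ n) (e %% 3 ^ n) *
          okB x (e %/ 3 ^ n) (e %% 3 ^ n).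
Proof. by rewrite /=; case: (hist x e). Qed.

(** An entry carries, shifted by 1, the number of the set B it was written for, so a stale entry
    still certifies a packing, only for another B. *)
Definition sound (t : nat -> nat) := forall j, t j != 0 ->
  exists S Q, [/\ j = code 3 S & packing (selB (t j).-1) S Q].

(** A nonempty [R] has the entry [b + 1], and injectivity of [code 3] turns it into a packing of [R]
    itself; a nonempty [T] joins as a new block. *)
Lemma succ_packing t b c : sound t -> succ x t b c = 1 ->
  exists Q, packing (selB b) (selT c :|: selR c) Q.
Proof.
move=> ht /eqP; rewrite succE => /andP[hT hR].
have [Q /andP[pQ gQ]] : exists Q, packing (selB b) (selR c) Q.
  case: eqP hR => [-> _|_ /= /eqP e].
    exists set0; rewrite /packing partition_set0 eqxx /=.
    by apply/forall_inP=> Y; rewrite inE.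
  have [|S [Q [/code_inj <-]]] := ht (code 3 (selR c)); first by rewrite e addn1.
  by rewrite e addn1; exists Q.
case: (eqVneq (selT c) set0) hT => [-> _|T0 /= gT].
  by exists Q; rewrite set0U /packing pQ.
exists (selT c |: Q); rewrite /packing partitionU1 ?pQ ?T0 ?sel_disjoint //=.
by apply/forall_inP=> Y; rewrite !inE => /orP[/eqP->//|/(forall_inP gQ)].
Qed.

Lemma hist_sound e : sound (tab e).
Proof.
elim: e => [|e IH] j //; rewrite tabS /=; case: ifP => [/eqP ->|_]; last exact: IH.
set b := e %/ _; set c := e %% _; set v := tab e _.
have := succ_le1 (tab e) b c.
case E: (succ x _ b c) => [|[|//]] _; first by rewrite mul0n addn0; exact: IH.
(* By truncation, an entry that is already at least [b + 1] stays unchanged. *)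
rewrite mul1n => _; case: (leqP (b + 1) v) => vb.
  have -> : v + (b + 1 - v) = v by lia.
  by apply: IH; rewrite -lt0n; apply: leq_trans vb; rewrite addn1.
have [Q pQ] := succ_packing IH E.
have -> : v + (b + 1 - v) = b.+1 by lia.
by exists (selT c :|: selR c), Q.
Qed.

Lemma acc_sound e : acc e != 0 -> exists B Q,
  [/\ load B <= D, one_group B & packing B (~: B) Q].
Proof.
elim: e => // e IH; rewrite accS addn_eq0 negb_and => /orP[/IH //|].
rewrite muln_eq0 negb_or => /andP[]; set b := e %/ _; set c := e %% _.
move=> h1 h2.
have {}h1 : succ x (tab e) b c = 1.
  by have := succ_le1 (tab e) b c; case: (succ _ _ _ _) h1 => [|[|]].
have {h2} /eqP : okB x b c = 1.
  have : okB x b c <= 1 by exact: leq_subr.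
  by case: (okB _ _ _) h2 => [|[|]].
rewrite okBE => /and3P[hB gB /eqP cov].
have [Q] := succ_packing (@hist_sound e) h1; rewrite cov => pQ.
by exists (selB b), Q.
Qed.

Lemma acc_mono e e' : e <= e' -> acc e <= acc e'.
Proof.
move=> h; rewrite -(subnK h); elim: (e' - e) => // k IH.
by rewrite addSn accS; apply: leq_trans IH (leq_addr _ _).
Qed.

(** Ensures that a successful update [v + (b + 1 - v)] yields exactly [b + 1]. *)
Lemma tab_le b e j : e <= b.+1 * 3 ^ n -> tab e j <= b.+1.
Proof.
elim: e j => // e IH j he; rewrite tabS /=.
have {}IH := fun j => IH j (ltnW he).
case: eqP => _; last exact: IH.
have hb : e %/ 3 ^ n <= b by rewrite -ltnS ltn_divLR ?expn_gt0.
have := succ_le1 (tab e) (e %/ 3 ^ n) (e %% 3 ^ n).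
set s := succ _ _ _ _; set v := tab e _ => hs.
have hv : v <= b.+1 by exact: IH.
by move: s hs hb => [|[|//]] _; lia.
Qed.

(** Up to the end of the rounds of [b], an update has a number at most [b], so its truncated
    difference with the entry [b + 1] is 0. *)
Lemma tab_persist b e e' j : e <= e' -> e' <= b.+1 * 3 ^ n ->
  tab e j = b.+1 -> tab e' j = b.+1.
Proof.
move=> h; rewrite -(subnK h); elim: (e' - e) => // k IH he' hj.
move: he'; rewrite addSn => he'; have {}IH := IH (ltnW he') hj.
rewrite tabS /=; case: eqP => // <-; rewrite IH.
have : (k + e) %/ 3 ^ n <= b by rewrite -ltnS ltn_divLR ?expn_gt0.
by rewrite addn1 -[_ <= b]subn_eq0 -subSS => /eqP ->; rewrite muln0 addn0.
Qed.

(** * Completeness for a fixed set B *)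

Section Complete.
Variable B : {set X}.
Let b := code 2 B.
Let start := b * 3 ^ n.

Lemma start_div c : c < 3 ^ n -> (start + c) %/ 3 ^ n = b.
Proof. by move=> hc; rewrite divnMDl ?expn_gt0 // divn_small ?addn0. Qed.

Lemma start_mod c : c < 3 ^ n -> (start + c) %% 3 ^ n = c.
Proof. by move=> hc; rewrite modnMDl modn_small. Qed.

Lemma start_lt c : c < 3 ^ n -> start + c < b.+1 * 3 ^ n.
Proof. by move=> hc; rewrite mulSn addnC ltn_add2r. Qed.

Lemma tab_filled c c' : c < c' -> c' < 3 ^ n ->
  succ x (tab (start + c)) b c = 1 ->
  tab (start + c') (code 3 (selT c :|: selR c)) = b.+1.
Proof.
move=> cc' hc' h; have hc := ltn_trans cc' hc'.
apply: (@tab_persist b (start + c).+1); rewrite ?ltn_add2l //.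
  exact: ltnW (start_lt hc').
rewrite tabS /= (start_div hc) (start_mod hc) eqxx h mul1n addn1.
by rewrite subnKC // tab_le // ltnW // start_lt.
Qed.

(** Induction on the size of [S], splitting off the block [Y] of some item and leaving [R]. The
    bound on [c] strengthens the induction: the pair found for [R] is below [2 * code 3 R], hence
    below [code_pair Y R], so the entry of [R] is filled in time. The bound is inherited because
    [code 3 Y > 0]; it fails for the empty set, whose entry is never consulted. *)
Lemma packing_succ S Q : packing B S Q ->
  exists c, [/\ c < 3 ^ n, S != set0 -> c < 2 * code 3 S,
    selT c :|: selR c = S & succ x (tab (start + c)) b c = 1].
Proof.
have [m hm] := ubnP #|S|; elim: m S Q hm => // m IH S Q hm /andP[pQ gQ].
case: (set_0Vmem S) => [S0|[y yS]].
  have d0 : [disjoint set0 & (set0 : {set X})] by rewrite -setI_eq0 setI0.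
  exists (code_pair set0 set0); rewrite S0 eqxx; split=> //.
  - exact: code_pair_lt.
  - by rewrite selT_pair // selR_pair // setU0.
  - by apply/eqP; rewrite succE selT_pair // selR_pair // eqxx.
have yQ : y \in cover Q by rewrite (cover_partition pQ).
set Y := pblock Q y; have YQ : Y \in Q by rewrite pblock_mem.
have yY : y \in Y by rewrite mem_pblock.
have YS : Y \subset S by exact: partitionS pQ YQ.
set R := S :\: Y.
have SYR : Y :|: R = S by rewrite /R -{1}(setIidPr YS) setID.
have dYR : [disjoint Y & R].
  by rewrite disjoints_subset; apply/subsetP=> z zY; rewrite !inE zY.
have pR : packing B R (Q :\ Y).
  rewrite /packing partitionD1 //=; apply/forall_inP=> Z.
  by rewrite inE => /andP[_]; exact: (forall_inP gQ).
have Rm : #|R| < m.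
  rewrite -ltnS; apply: leq_ltn_trans hm; apply: proper_card.
  by apply/properP; split; [exact: subsetDl|exists y; rewrite // !inE yY].
have [c' [hc' lt' eR hs]] := IH _ _ Rm pR.
have hc := code_pair_lt dYR.
have Y0 : Y != set0 by apply/set0Pn; exists y.
have codeS : code 3 S = code 3 Y + code 3 R by rewrite -code_setU ?SYR.
exists (code_pair Y R); split=> //.
- by move=> _; rewrite /code_pair codeS; have := code_gt0 Y0; lia.
- by rewrite selT_pair // selR_pair.
apply/eqP; rewrite succE selT_pair // selR_pair // selB_code.
rewrite (forall_inP gQ _ YQ) orbT /=; case: eqVneq => //= R0.
have c'c : c' < code_pair Y R := leq_trans (lt' R0) (leq_addl _ _).
by have := tab_filled c'c hc hs; rewrite eR addn1 => ->.
Qed.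

Lemma acc_complete Q : load B <= D -> one_group B -> packing B (~: B) Q ->
  acc (6 ^ n) != 0.
Proof.
move=> hB gB /packing_succ [c [hc _ cov hs]].
have hok : okB x b c = 1 by apply/eqP; rewrite okBE selB_code hB gB cov eqxx.
have lt6 : start + c < 6 ^ n.
  (* [6 ^ n] splits as [2 ^ n * 3 ^ n], and the number of [B] is below [2 ^ n]. *)
  apply: leq_trans (start_lt hc) _; rewrite (expnMn 2 3) leq_mul2r.
  by rewrite code2_lt orbT.
rewrite -lt0n; apply: leq_trans (acc_mono lt6).
by rewrite accS (start_div hc) (start_mod hc) hs hok addn1.
Qed.

End Complete.

Lemma acc_correct : acc (6 ^ n) != 0 <->
  exists B Q, [/\ load B <= D, one_group B & packing B (~: B) Q].
Proof.
split=> [/acc_sound //|[B [Q [h1 h2 h3]]]]; exact: acc_complete h3.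
Qed.

End Dynamic.

Import Order.TTheory GRing.Theory Num.Theory.

(** * Minimal feasible partitions *)

Section Minimal.
Variables (X : finType) (w : X -> rat).
Hypothesis w_gt0 : forall x, (0 < w x)%R.
Implicit Types (P Q : {set {set X}}) (A B Y Z : {set X}).

Definition wt Y : rat := (\sum_(y in Y) w y)%R.

Lemma wtU Y Z : [disjoint Y & Z] -> wt (Y :|: Z) = (wt Y + wt Z)%R.
Proof. by move=> d; rewrite /wt -bigU //=; apply: eq_bigl => y; rewrite !inE. Qed.

Lemma wt_sub Y Z : Y \subset Z -> (wt Y <= wt Z)%R.
Proof.
move=> YZ; rewrite -(setID Z Y) (setIidPr YZ) wtU.
  by rewrite lerDl sumr_ge0 // => y _; apply: ltW.
by rewrite disjoints_subset; apply/subsetP=> z zY; rewrite !inE zY.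
Qed.

Lemma trivIset_disjoint P Y Z : trivIset P -> Y \in P -> Z \in P -> Y != Z ->
  [disjoint Y & Z].
Proof. by move/trivIsetP; apply. Qed.

(** Two blocks that fit together can be merged into a coarser feasible partition. Conversely, a
    different feasible partition coarser than [P] has a block including two blocks of [P], and this
    block weighs more than 1. *)
Lemma minimal_pairs P : minimal_feasible w P <-> feasible w P /\
  forall Y Z, Y \in P -> Z \in P -> Y != Z -> (1 < wt Y + wt Z)%R.
Proof.
split.
  case/andP=> fP /negP mP; split=> // Y Z YP ZP YZ; rewrite ltNge.
  apply/negP=> le1; apply: mP; case/andP: fP => pP wP.
  case/and3P: (pP) => _ tP nP.
  have dYZ := trivIset_disjoint tP YP ZP YZ.
  have Y0 : Y != set0 by apply: contraNneq nP => <-.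
  have Z0 : Z != set0 by apply: contraNneq nP => <-.
  have pYZ : partition (P :\ Y :\ Z) ([set: X] :\: Y :\: Z).
    apply: partitionD1; last by rewrite !inE ZP eq_sym YZ.
    exact: partitionD1.
  have pU : partition ((Y :|: Z) |: (P :\ Y :\ Z)) [set: X].
    have -> : [set: X] = (Y :|: Z) :|: ([set: X] :\: Y :\: Z).
      by apply/setP=> y; rewrite !inE; case: (y \in Y); case: (y \in Z).
    apply: partitionU1 => //.
      by apply: contraNneq Y0 => h; rewrite -subset0 -h subsetUl.
    rewrite disjoints_subset; apply/subsetP=> z; rewrite !inE.
    by case: (z \in Y); case: (z \in Z).
  apply/existsP; exists ((Y :|: Z) |: (P :\ Y :\ Z)); apply/and3P; split.
  - rewrite /feasible pU /=; apply/forall_inP=> A.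
    rewrite !inE => /orP[/eqP->|/and3P[_ _ AP]].
      by rewrite -/(wt _) wtU.
    exact: (forall_inP wP).
  (* If merging changed nothing, [Y] would equal the union and include [Z], which is nonempty and
     disjoint from [Y]. *)
  - apply/eqP=> e; move: YP; rewrite -e !inE eqxx andbF orbF => /eqP eY.
    move: dYZ; rewrite disjoint_sym => /disjoint_setI0 h.
    move: Z0; rewrite -h => /eqP; apply; rewrite h; apply/eqP.
    rewrite -subset0 -h subsetI subxx /= eY; exact: subsetUr.
  - apply/forall_inP=> A AP; apply/exists_inP.
    have [->|AY] := eqVneq A Y.
      by exists (Y :|: Z); [rewrite setU11|exact: subsetUl].
    have [->|AZ] := eqVneq A Z.
      by exists (Y :|: Z); [rewrite setU11|exact: subsetUr].
    by exists A => //; rewrite !inE AY AZ AP orbT.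
case=> fP hP; rewrite /minimal_feasible fP /=; apply/negP.
case/existsP=> Q /and3P[fQ QP /forall_inP le].
case/andP: fP => pP _; case/andP: fQ => pQ wQ.
case/and3P: (pP) => /eqP cP tP nP; case/and3P: (pQ) => /eqP cQ tQ nQ.
(* Each block of [Q] is a union of blocks of [P]. *)
have block A y : A \in Q -> y \in A -> pblock P y \subset A.
  move=> AQ yA; have yP : y \in cover P by rewrite cP inE.
  have /exists_inP[A' A'Q sub] := le _ (pblock_mem yP).
  have yA' : y \in A' by apply: (subsetP sub); rewrite mem_pblock.
  by rewrite -(def_pblock tQ AQ yA) (def_pblock tQ A'Q yA').
have QsubP A : A \in Q -> A \in P.
  move=> AQ; have /set0Pn[y yA] : A != set0 by apply: contraNneq nQ => <-.
  have yP : y \in cover P by rewrite cP inE.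
  suff -> : A = pblock P y by rewrite pblock_mem.
  apply/eqP; rewrite eqEsubset (block _ _ AQ yA) andbT.
  apply/subsetP=> z zA; apply: contraT => zY.
  have zP : z \in cover P by rewrite cP inE.
  have ne : pblock P y != pblock P z.
    by apply: contraNneq zY => ->; rewrite mem_pblock.
  have := hP _ _ (pblock_mem yP) (pblock_mem zP) ne.
  rewrite -wtU; last exact: trivIset_disjoint tP (pblock_mem yP) (pblock_mem zP) ne.
  rewrite ltNge; move/negP; case; apply: le_trans (forall_inP wQ _ AQ).
  by apply: wt_sub; rewrite subUset !block.
(* All blocks of [Q] belong to [P] and both cover everything, so the two partitions coincide. *)
move/negP: QP; apply; apply/eqP/setP=> A; apply/idP/idP=> [/QsubP //|AP].
have /set0Pn[y yA] : A != set0 by apply: contraNneq nP => <-.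
have yQ : y \in cover Q by rewrite cQ inE.
have BQ := pblock_mem yQ; have BP := QsubP _ BQ.
have yB : y \in pblock Q y by rewrite mem_pblock.
by rewrite -(def_pblock tP AP yA) (def_pblock tP BP yB).
Qed.

Variable G : {set {set X}}.
Hypothesis G_part : partition G [set: X].

Definition within Y := forall y z, y \in Y -> z \in Y -> pblock G y = pblock G z.

(** Refinement of [G] becomes a condition on single blocks, which can be tested for each [T]
    separately. *)
Lemma le_part_within P : partition P [set: X] ->
  (le_part G P <-> forall Y, Y \in P -> within Y).
Proof.
case/and3P: G_part => /eqP cG tG nG; case/and3P=> _ _ nP; split.
  move=> /forall_inP h Y YP y z yY zY.
  have /exists_inP[A AG sub] := h _ YP.
  by rewrite (def_pblock tG AG (subsetP sub _ yY)) (def_pblock tG AG (subsetP sub _ zY)).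
move=> h; apply/forall_inP=> Y YP; apply/exists_inP.
have /set0Pn[y yY] : Y != set0 by apply: contraNneq nP => <-.
have cov z : z \in cover G by rewrite cG inE.
exists (pblock G y); first by rewrite pblock_mem.
by apply/subsetP=> z zY; rewrite (h Y YP y z) // mem_pblock.
Qed.

(* [B] is a lightest block; it is empty only if there are no items at all. *)
Lemma minimal_extension :
  (exists P, minimal_feasible w P /\ le_part G P) <->
  exists B Q, [/\ (wt B <= 1)%R, within B, partition Q (~: B) &
    forall Y, Y \in Q -> [/\ (wt Y <= 1)%R, within Y, (wt B <= wt Y)%R &
                            (1 < wt Y + wt B)%R]].
Proof.
split=> [[P [/minimal_pairs[/andP[pP wP] hP]]]|[B [Q [hB gB pQ hQ]]]].
  move/(le_part_within pP) => gP.
  have wt0 : wt set0 = 0%R by rewrite /wt big_set0.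
  case: (set_0Vmem P) => [P0|[B0 B0P]].
    exists set0, set0; rewrite wt0; split=> //; first by move=> y; rewrite inE.
      by rewrite setC0 -P0.
    by move=> Y; rewrite inE.
  have [B BP minB] := arg_minP wt B0P.
  exists B, (P :\ B); split; [exact: (forall_inP wP)|exact: gP| |].
    by rewrite -setTD; exact: partitionD1.
  move=> Y; rewrite !inE => /andP[YB YP].
  by split; [exact: (forall_inP wP)|exact: gP|exact: minB|exact: hP].
(* With [B] empty, a block of [Q] would weigh both at most 1 and more than 1, so [Q] is empty
   too. *)
have [B0|B0] := eqVneq B set0.
  have Q0 : Q = set0.
    apply/eqP/negPn/negP=> /set0Pn[Y YQ]; case: (hQ Y YQ) => h _ _.
    by rewrite B0 {2}/wt big_set0 addr0 ltNge h.
  exists Q; rewrite B0 setC0 in pQ; split.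
    apply/minimal_pairs; split; last by move=> Y Z; rewrite Q0 inE.
    by rewrite /feasible pQ /=; apply/forall_inP=> Y; rewrite Q0 inE.
  by apply/le_part_within => // Y; rewrite Q0 inE.
have pP : partition (B |: Q) [set: X].
  rewrite -(setUCr B); apply: partitionU1 => //.
  by rewrite disjoints_subset setCK.
exists (B |: Q); split; last first.
  by apply/le_part_within => // Y; rewrite !inE => /orP[/eqP->//|/hQ[]].
apply/minimal_pairs; split.
  rewrite /feasible pP /=; apply/forall_inP=> Y.
  by rewrite !inE => /orP[/eqP->//|/hQ[]].
move=> Y Z; rewrite !inE => /orP[/eqP->|YQ] /orP[/eqP->|ZQ]; rewrite ?eqxx // => _.
- by rewrite addrC; case: (hQ _ ZQ).
- by case: (hQ _ YQ).
(* [B] is no heavier than [Z], so already the weight of [Y] and [B] together forces that of [Y] and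
   [Z] above 1. *)
- case: (hQ _ YQ) => _ _ _ h; case: (hQ _ ZQ) => _ _ hZ _.
  by apply: lt_le_trans h _; rewrite lerD2l.
Qed.

End Minimal.

(** * The encoded instance *)

Section Instance.
Variable I : ext_bp.
Local Notation X := (item I).
Local Notation w := (@weight I).
Local Notation G := (pre_sol I).
Local Notation x := (encode_ext_bp I).
Local Notation n := (input_at x 0).

Lemma nth_flatten3 (T : Type) (y0 : T) (f g h : T -> nat) (s : seq T) i k :
  i < size s -> k < 3 ->
  nth 0 (flatten [seq [:: f y; g y; h y] | y <- s]) (3 * i + k) =
  nth 0 [:: f (nth y0 s i); g (nth y0 s i); h (nth y0 s i)] k.
Proof.
elim: s i => // y s IH [|i] hi hk.
  by case: k hk {IH} => [|[|[|]]].
by rewrite mulnS -addnA /= IH.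
Qed.

Definition num y := `|numq (w y)|%N.
Definition den y := `|denq (w y)|%N.
Definition first_mate y := find (fun z => z \in pblock G y) (enum X).

Lemma n_items : n = #|X|. Proof. by []. Qed.

Lemma input_item (y : X) k : k < 3 ->
  nth 0 x (3 * itm y + 1 + k) = nth 0 [:: num y; den y; first_mate y] k.
Proof.
move=> hk; rewrite addn1 addSn /=.
rewrite (nth_flatten3 y _ _ _ _ hk) -?cardE ?ltn_ord //.
by rewrite /itm nth_enum_rank.
Qed.

Lemma in_num_item y : in_num x (itm y) = num y.
Proof. by rewrite -[RHS](@input_item y 0) // addn0. Qed.

Lemma in_den_item y : in_den x (itm y) = den y.
Proof. exact: (@input_item y 1). Qed.

Lemma in_grp_item y : in_grp x (itm y) = (first_mate y).+1.
Proof. by rewrite /in_grp /input_at (@input_item y 2) // addn1. Qed.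

Lemma weight_gt0 y : (0 < w y)%R.
Proof. by case/andP: (weight_bounds y). Qed.

Lemma den_gt0 y : 0 < den y.
Proof. by rewrite absz_gt0 denq_neq0. Qed.

Lemma num_gt0 y : 0 < num y.
Proof. by rewrite absz_gt0 numq_eq0 gt_eqF // weight_gt0. Qed.

Lemma weight_frac y : w y = ((num y)%:R / (den y)%:R)%R.
Proof.
rewrite -[LHS]divq_num_den !natr_absz !ger0_norm //.
by rewrite numq_ge0 ltW // weight_gt0.
Qed.

Lemma num_le_den y : num y <= den y.
Proof.
have : (w y <= 1)%R by case/andP: (weight_bounds y) => _ /ltW.
by rewrite weight_frac ler_pdivrMr ?ltr0n ?den_gt0 // mul1r ler_nat.
Qed.

Lemma den_prod_items : den_prod x n = \prod_y den y.
Proof.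
rewrite /den_prod n_items (reindex (@enum_rank X)) /=; last first.
  exact: onW_bij (@enum_rank_bij X).
by apply: eq_bigr => y _; rewrite -in_den_item.
Qed.

Lemma den_prod_gt0 : 0 < den_prod x n.
Proof. by rewrite den_prod_items prodn_gt0 // => y; exact: den_gt0. Qed.

Lemma den_dvd y : den y %| den_prod x n.
Proof. by rewrite den_prod_items (bigD1 y) //= dvdn_mulr. Qed.

Lemma scaled_item y : scaled x (itm y) = num y * (den_prod x n %/ den y).
Proof. by rewrite /scaled in_num_item in_den_item. Qed.

Lemma scaled_item_gt0 (y : X) : 0 < scaled x (itm y).
Proof.
rewrite scaled_item muln_gt0 num_gt0 divn_gt0 ?den_gt0 //=.
by rewrite dvdn_leq ?den_prod_gt0 ?den_dvd.
Qed.

(** The division in [scaled] is exact, since each denominator divides the product of all of them. *)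
Lemma scaled_weight (y : X) :
  ((scaled x (itm y))%:R = w y * (den_prod x n)%:R :> rat)%R.
Proof.
have d0 : ((den y)%:R != 0 :> rat)%R by rewrite pnatr_eq0 -lt0n den_gt0.
rewrite scaled_item -{2}(divnK (den_dvd y)) !natrM weight_frac.
by rewrite mulrCA mulrAC -mulrA divff // mulr1 mulrC.
Qed.

Lemma load_wt Y : ((load x Y)%:R = wt w Y * (den_prod x n)%:R :> rat)%R.
Proof.
rewrite /load /wt natr_sum big_distrl /=.
by apply: eq_bigr => y _; rewrite scaled_weight.
Qed.

Lemma wt_load Y : (wt w Y = (load x Y)%:R / (den_prod x n)%:R)%R.
Proof. by rewrite load_wt mulfK // pnatr_eq0 -lt0n den_prod_gt0. Qed.

Lemma wt_le1 Y : (wt w Y <= 1)%R = (load x Y <= den_prod x n).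
Proof.
by rewrite wt_load ler_pdivrMr ?ltr0n ?den_prod_gt0 // mul1r ler_nat.
Qed.

Lemma wt_le Y Z : (wt w Y <= wt w Z)%R = (load x Y <= load x Z).
Proof.
by rewrite !wt_load ler_pM2r ?invr_gt0 ?ltr0n ?den_prod_gt0 // ler_nat.
Qed.

Lemma wt_gt1 Y Z :
  (1 < wt w Y + wt w Z)%R = (den_prod x n < load x Y + load x Z).
Proof.
by rewrite !wt_load -mulrDl -natrD ltr_pdivlMr ?ltr0n ?den_prod_gt0 // mul1r ltr_nat.
Qed.

(** The rank of its first item names a block: equal ranks exhibit a common item, and blocks that
    meet coincide. *)
Lemma first_mateP y z : (first_mate y = first_mate z) <-> pblock G y = pblock G z.
Proof.
case/and3P: (pre_sol_partition I) => /eqP cG tG _.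
have cov u : u \in cover G by rewrite cG inE.
have hfind u : nth u (enum X) (first_mate u) \in pblock G u.
  by apply: nth_find; apply/hasP; exists u; rewrite ?mem_enum ?mem_pblock.
have lt u : first_mate u < size (enum X).
  by rewrite -has_find; apply/hasP; exists u; rewrite ?mem_enum ?mem_pblock.
split=> [e|e]; last by rewrite /first_mate e.
have h1 := hfind y; have := hfind z.
(* The two occurrences of [nth] differ in their default, which is irrelevant as the index is in
   range. *)
rewrite -e (set_nth_default y) // => h2.
by rewrite -(def_pblock tG (pblock_mem (cov y)) h1)
           -(def_pblock tG (pblock_mem (cov z)) h2).
Qed.

Lemma one_groupP Y : one_group x Y <-> within G Y.
Proof.
split=> [h y z yY zY|h].
  move/forall_inP: h => /(_ y yY) /forall_inP /(_ z zY).
  by rewrite !in_grp_item eqSS => /eqP /first_mateP.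
apply/forall_inP=> y yY; apply/forall_inP=> z zY.
by rewrite !in_grp_item; apply/eqP; congr _.+1; apply/first_mateP; exact: h.
Qed.

Lemma ext_bp_yesP : (hist x (6 ^ n)).1 != 0 <-> ext_bp_yes I.
Proof.
apply: (iff_trans (acc_correct n_items scaled_item_gt0)).
apply: iff_trans (iff_sym (minimal_extension weight_gt0 (pre_sol_partition I))).
split=> -[B [Q]].
  case=> hB /one_groupP gB /andP[pQ /forall_inP gQ]; exists B, Q.
  split=> //; first by rewrite wt_le1.
  move=> Y /gQ /and4P[h1 /one_groupP h2 h3 h4].
  by rewrite wt_le1 wt_le wt_gt1.
case=> hB gB pQ gQ; exists B, Q; rewrite -wt_le1; split=> //.
  exact/one_groupP.
rewrite /packing pQ /=; apply/forall_inP=> Y /gQ[h1 h2 h3 h4].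
by apply/and4P; rewrite -wt_le1 -wt_le -wt_gt1; split=> //; apply/one_groupP.
Qed.

(** * Sizes *)

Local Notation N := (input_size x).

Lemma leq_pow_nbits a : a <= 2 ^ nbits a.
Proof. by rewrite ltnW // /nbits trunc_log_ltn. Qed.

Lemma nbits_le a k : a <= 2 ^ k -> nbits a <= k.+1.
Proof.
case: a => [|a] h; first by rewrite /nbits trunc_log0.
rewrite /nbits ltnS -(@leq_exp2l 2) //; apply: leq_trans h.
exact: trunc_logP.
Qed.

Lemma input_sizeE :
  N = nbits #|X| + \sum_y (nbits (num y) + nbits (den y) + nbits (first_mate y)).
Proof.
rewrite /input_size big_cons big_flatten /= big_map big_enum /=; congr (_ + _).
by apply: eq_bigr => y _; rewrite !big_cons big_nil addn0 addnA.
Qed.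

Lemma input_size_gt0 : 0 < N. Proof. by rewrite input_sizeE. Qed.

Lemma items_le_size : 3 * n <= N.
Proof.
rewrite input_sizeE n_items; apply: leq_trans (leq_addl _ _).
rewrite mulnC -sum_nat_const; apply: leq_sum => y _.
by rewrite /nbits; lia.
Qed.

Lemma input_le i : nth 0 x i <= 2 ^ N.
Proof.
case: (ltnP i (size x)) => hi; last by rewrite nth_default.
apply: leq_trans (leq_pow_nbits _) _; rewrite leq_exp2l //.
by rewrite /input_size (big_nth 0) big_mkord (bigD1 (Ordinal hi)) //= leq_addr.
Qed.

(** A product is at most 2 to the total length of its factors, and all denominators are part of the
    input; so scaling keeps the numbers short. Partial products divide the full one. *)
Lemma den_prod_le j : j <= n -> den_prod x j <= 2 ^ N.
Proof.
move=> jn; apply: leq_trans (_ : den_prod x n <= _).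
  apply: dvdn_leq; first exact: den_prod_gt0.
  rewrite /den_prod -(subnKC jn) big_split_ord /=.
  exact: dvdn_mulr.
rewrite den_prod_items.
apply: leq_trans (_ : \prod_y 2 ^ nbits (den y) <= _).
  by apply: leq_prod => y _; exact: leq_pow_nbits.
rewrite -expn_sum leq_exp2l // input_sizeE.
by apply: leq_trans (leq_addl _ _); apply: leq_sum => y _; lia.
Qed.

Lemma in_num_le_den i : i < n -> in_num x i <= in_den x i.
Proof.
move: i; apply/(all_items n_items) => y.
by rewrite in_num_item in_den_item num_le_den.
Qed.

End Instance.

(** * Assembling the time and space bounds *)

Lemma const_bound (p : program) : exists C, forall i, i < size p ->
  static_cost (nth (Const 0 0) p i) <= C.
Proof.
eexists => i hi; exact: (leq_bigmax (F := fun i : 'I_(size p) =>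
  static_cost (nth (Const 0 0) p i)) (Ordinal hi)).
Qed.

Lemma horner_monomial (c d N : nat) : (c *: 'X^d : {poly nat})%R.[N]%R = c * N ^ d.
Proof.
by rewrite hornerZ hornerXn.
Qed.

Lemma sim_init : sim init_config.2 (nseq nvars 0, fun _ => 0).
Proof.
have get0 r : get init_config.2 r = 0 by rewrite /get fnd_fmap0.
by split=> *; rewrite get0 // nth_nseq if_same.
Qed.

Lemma good_init A V : good A V init_config.2.
Proof.
by split=> r; [rewrite /get fnd_fmap0|rewrite inE].
Qed.

Lemma run_bounds p x A V k c C Bd : reach p x A V init_config k c ->
  (forall a, a <= V -> nbits a <= Bd) -> (forall a, a < A -> nbits a <= Bd) ->
  (forall i, nth 0 x i <= V) ->
  (forall i, i < size p -> static_cost (nth (Const 0 0) p i) <= C) ->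
  run_time p x k <= k * (C + Bd * Bd + 2 * Bd) /\
  run_space p x k <= A * (2 * Bd).
Proof.
move=> [_ g] hV hA hx hC; split.
  apply: (@leq_trans (\sum_(i < k) (C + Bd * Bd + 2 * Bd))); last first.
    by rewrite sum_nat_const card_ord.
  apply: leq_sum => i _; apply: (step_cost_le _ hV hx hC).
  by apply: g; exact: ltnW.
apply/bigmax_leqP => i _; apply: (mem_space_le _ hV hA).
by apply: g; rewrite -ltnS.
Qed.

(** Degree 3 arises from the loop over the items, linear in [N], and the quadratic cost of
    arithmetic on numbers of [W * N] bits. *)
Lemma time_arith s m N P C W : 0 < N -> m < 2 * N ->
  5 * ((s + 3) * m.+1 * P) * (C + W * N * (W * N) + 2 * (W * N)) <=
  10 * (s + 3) * (C + W * W + 2 * W) * N ^ 3 * P.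
Proof.
move=> N0 mN.
have h1 : C + W * N * (W * N) + 2 * (W * N) <= (C + W * W + 2 * W) * (N * N).
  have hC : C <= C * (N * N) by rewrite leq_pmulr // muln_gt0 N0.
  have hW : 2 * (W * N) <= 2 * W * (N * N) by rewrite mulnA leq_mul2l leq_pmulr ?orbT.
  by rewrite 2!mulnDl (mulnACA W N W N) leq_add // leq_add.
have h2 : 5 * ((s + 3) * m.+1 * P) <= 5 * ((s + 3) * (2 * N) * P).
  by rewrite leq_mul2l leq_mul2r leq_mul2l mN !orbT.
apply: leq_trans (leq_mul h2 h1) _; apply: eq_leq.
by move: (C + _ + _) (s + 3) => c t; rewrite !expnS expn0 muln1; lia.
Qed.

Lemma space_arith t W N P : 0 < P ->
  (t + P) * (2 * (W * N)) <= (t + 1) * (2 * W) * N * P.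
Proof.
move=> P0; have h : t + P <= (t + 1) * P.
  by rewrite mulnDl mul1n leq_add2r leq_pmulr.
apply: leq_trans (leq_mul h (leqnn _)) _; apply: eq_leq.
by move: (t + 1) => u; lia.
Qed.

Theorem theorem15 :
  solvable_Ostar encode_ext_bp nb_items ext_bp_yes
    (fun n => 6 ^ n) (fun n => 3 ^ n).
Proof.
have [C hC] := const_bound ext_bp_program.
(* Values are at most [2 ^ (5 * N * weight_max)], so their length is at most
   [5 * N * weight_max + 1 <= W * N]. *)
pose W := 5 * weight_max + 1.
exists ext_bp_program.
exists (10 * (size_max + 3) * (C + W * W + 2 * W) *: 'X^3)%R.
exists ((tab_base + 1) * (2 * W) *: 'X^1)%R => I x N.
have N0 : 0 < N := input_size_gt0 I.
have nN : 3 * input_at x 0 <= N := items_le_size I.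
have [k hk r] := main_run N0 nN (@input_le I) (@den_prod_le I) (@in_num_le_den I).
set A := _ + _ in r; set V := 2 ^ _ in r.
have wm : tab_base < weight_max.
  by have [_ [h _ _]] := lt_weight_max; apply: leq_ltn_trans (leq_addl _ _) h.
have AV : tab_base <= A by rewrite leq_addr.
have W0 : weight_max * (5 * N) < W * N by rewrite /W; nia.
(* Addresses do not exceed [V] either, so the length bound for values also serves for them. *)
have n3V : tab_base + 3 ^ input_at x 0 <= V.
  apply: (@leq_trans (2 ^ tab_base * 2 ^ N)).
    have h1 := ltn_expl tab_base (isT : 1 < 2).
    have h2 : 3 ^ input_at x 0 <= 2 ^ N.
      exact: leq_trans (pow3_le6 _) (pow6_le N0 nN (leqnn _)).
    have h3 : 0 < 2 ^ N by rewrite expn_gt0.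
    by nia.
  by rewrite -expnD leq_exp2l //; nia.
have bV : tab_base <= V := leq_trans (leq_addr _ _) n3V.
have hV a : a <= V -> nbits a <= W * N.
  by move=> /nbits_le h; apply: leq_trans h _; rewrite mulnC.
have hA a : a < A -> nbits a <= W * N.
  by move=> aA; apply: hV; apply: leq_trans (ltnW aA) n3V.
have hx i : nth 0 x i <= V.
  apply: leq_trans (input_le I i) _; rewrite leq_exp2l // mulnAC.
  by rewrite leq_pmull // muln_gt0 (leq_ltn_trans _ wm).
have code0 : code_at ext_bp_program 0 (compile main_cmd 0) by [].
have [M rM [_ sM _]] :=
  comp_ok AV bV r main_cmd_wf sim_init (good_init A V) code0.
have [ht hs] := run_bounds rM hV hA hx hC.
exists k; split.
- by case: rM => e _; rewrite /halted /config_at e.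
- apply: iff_trans (ext_bp_yesP I).
  (* By [sim], register 0 holds the head of [item_vals], the accumulator after all [6 ^ n]
     rounds. *)
  by case: rM => e _; rewrite /accepting /config_at e sM.
- rewrite horner_monomial; apply: leq_trans ht _.
  apply: leq_trans (leq_mul hk (leqnn _)) _.
  by apply: time_arith => //; lia.
- rewrite horner_monomial expn1; apply: leq_trans hs _.
  by apply: space_arith; rewrite // expn_gt0.
Qed.
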